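(* Let $\{G_n\}_{n\ge 1}$ be a sequence of non-trivial finite groups. The warp-transpose top with random shuffle on $\mathcal{G}_n=G_n\wr S_n$ (the random walk driven by the probability measure $P$) has total variation cutoff at time $n\log n$. That is, for every $\epsilon\in(0,1)$: 1. with $k_n=\lfloor(1+\epsilon)n\log n\rfloor$, $\displaystyle\lim_{n\to\infty}\|P^{*k_n}-U_{\mathcal{G}_n}\|_{\mathrm{TV}}=0$; 2. with $k_n=\lfloor(1-\epsilon)n\log n\rfloor$, $\displaystyle\lim_{n\to\infty}\|P^{*k_n}-U_{\mathcal{G}_n}\|_{\mathrm{TV}}=1$.
   Context: For a finite group $G$, the wreath product $G\wr S_n$ consists of tuples $(g_1,\dots,g_n;\pi)$ with $g_i\in G$, $\pi\in S_n$, with multiplication $(g_1,\dots,g_n;\pi)(h_1,\dots,h_n;\eta)=(g_1h_{\pi^{-1}(1)},\dots,g_nh_{\pi^{-1}(n)};\pi\eta)$. Write $\mathrm{e}$ for the identity of $G_n$ and $\mathrm{id}$ for the identity of $S_n$. The probability measure $P$ on $\mathcal{G}_n=G_n\wr S_n$ gives mass $\frac{1}{n|G_n|}$ to each element $(\mathrm{e},\dots,\mathrm{e},g;\mathrm{id})$, $g\in G_n$, and mass $\frac{1}{n|G_n|}$ to each element $(\mathrm{e},\dots,\mathrm{e},g^{-1},\mathrm{e},\dots,\mathrm{e},g;(i,n))$ ($g^{-1}$ in position $i$, $g$ in position $n$, $(i,n)$ a transposition), $g\in G_n$, $1\le i<n$; all other elements have mass $0$. For probability measures $p,q$ on a finite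 group $H$, $(p*q)(x)=\sum_{y\in H}p(xy^{-1})q(y)$, and $p^{*k}$ is the $k$-fold convolution of $p$ with itself. $U_H$ is the uniform distribution on $H$, and $\|\mu-\nu\|_{\mathrm{TV}}=\sup_{A\subset H}|\mu(A)-\nu(A)|=\frac12\sum_{x\in H}|\mu(x)-\nu(x)|$. *)

(* Defs.v *)
From HB Require Import structures.
From mathcomp Require Import all_boot all_order all_fingroup all_algebra.
From mathcomp Require Import all_classical all_reals all_analysis.

Set Implicit Arguments.
Unset Strict Implicit.
Unset Printing Implicit Defensive.

Import Order.TTheory GRing.Theory Num.Theory.

(* The positions 1, ..., n are the ordinals 0, ..., n - 1 of 'I_n. *)
Record wreath (gT : finGroupType) (n : nat) := Wreath {
  wcoord : {ffun 'I_n -> gT};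
  wperm : 'S_n
}.

Section WreathGroup.
Context (gT : finGroupType) (n : nat).
Implicit Types x y z : wreath gT n.

Definition wreath_pair x : {ffun 'I_n -> gT} * 'S_n := (wcoord x, wperm x).
Definition pair_wreath (p : {ffun 'I_n -> gT} * 'S_n) := Wreath p.1 p.2.

Lemma wreath_pairK : cancel wreath_pair pair_wreath.
Proof. by case. Qed.

HB.instance Definition _ := Finite.copy (wreath gT n) (can_type wreath_pairK).

Local Open Scope group_scope.

(* Products in {perm T} compose from left to right, (s * t) i = t (s i),
   whereas pi eta in (g; pi)(h; eta) = (_; pi eta) is the composition
   i |-> pi (eta i) (the only reading making the product associative),
   hence the reversed order of the permutations. *)
Definition wreath_mul x y : wreath gT n :=
  Wreath [ffun i => wcoord x i * wcoord y ((wperm x)^-1 i)]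
         (wperm y * wperm x).

Definition wreath_one : wreath gT n := Wreath [ffun=> 1] 1.

Definition wreath_inv x : wreath gT n :=
  Wreath [ffun i => (wcoord x (wperm x i))^-1] (wperm x)^-1.

Lemma wreath_mulA : associative wreath_mul.
Proof.
move=> x y z; congr Wreath; rewrite /= ?mulgA //.
by apply/ffunP => i; rewrite !ffunE /= mulgA invMg permM.
Qed.

Lemma wreath_mul1 : left_id wreath_one wreath_mul.
Proof.
case=> g s; congr Wreath; rewrite /= ?mulg1 //.
by apply/ffunP => i; rewrite !ffunE /= invg1 perm1 mul1g.
Qed.

Lemma wreath_mulV : left_inverse wreath_one wreath_inv wreath_mul.
Proof.
move=> x; congr Wreath; rewrite /= ?mulgV //.
by apply/ffunP => i; rewrite !ffunE /= invgK mulVg.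
Qed.

HB.instance Definition _ := Finite_isGroup.Build (wreath gT n)
  wreath_mulA wreath_mul1 wreath_mulV.

End WreathGroup.

Local Open Scope ring_scope.

Section FiniteGroupLaws.
Context (R : realType) (H : finGroupType).
Implicit Types p q mu nu : H -> R.

Definition conv p q : H -> R := fun x => \sum_(y : H) p (x * y^-1)%g * q y.

(* The power k = 0 is the point mass at the identity. *)
Definition conv_pow p (k : nat) : H -> R :=
  iter k (conv p) (fun x => (x == 1%g)%:R).

Definition uniform : H -> R := fun=> #|H|%:R^-1.

(* H has finitely many subsets, so the supremum is a maximum; the default
   value 0 is harmless since all the terms are nonnegative. *)
Definition tv_dist mu nu : R :=
  \big[Num.max/0]_(A : {set H}) `|\sum_(x in A) mu x - \sum_(x in A) nu x|.

Lemma tv_dist_sum mu nu : \sum_x mu x = \sum_x nu x ->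
  tv_dist mu nu = 2^-1 * \sum_x `|mu x - nu x|.
Proof.
move=> eq_mass; pose f x := mu x - nu x.
have sum_f : \sum_x f x = 0 by rewrite sumrB eq_mass subrr.
have splitA (A : {set H}) F :
    \sum_x F x = \sum_(x in A) F x + \sum_(x in ~: A) F x :> R.
  rewrite (bigID (mem A)) /=; congr (_ + _).
  by apply: eq_bigl => x; rewrite inE.
rewrite /tv_dist; apply/le_anti/andP; split.
  apply: bigmax_le => [|A _].
    by rewrite mulr_ge0 ?invr_ge0 // sumr_ge0.
  rewrite -sumrB ler_pdivlMl // mulr2n mulrDl !mul1r.
  rewrite (splitA A (fun x => `|mu x - nu x|)) lerD //; first exact: ler_norm_sum.
  have /eqP := sum_f; rewrite (splitA A f) addr_eq0 => /eqP ->.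
  by rewrite normrN ler_norm_sum.
pose A := [set x | 0 <= f x].
apply: le_trans (le_bigmax _ _ A); rewrite /= -sumrB.
have posA : \sum_(x in A) `|f x| = \sum_(x in A) f x.
  by apply: eq_bigr => x; rewrite inE => /ger0_norm.
have negA : \sum_(x in ~: A) `|f x| = - \sum_(x in ~: A) f x.
  rewrite -sumrN; apply: eq_bigr => x; rewrite !inE -ltNge => /ltW.
  exact: ler0_norm.
rewrite ler_pdivrMl // (splitA A (fun x => `|mu x - nu x|)) posA negA.
have /eqP := sum_f; rewrite (splitA A f) addrC addr_eq0 => /eqP ->.
by rewrite opprK mulr2n mulrDl !mul1r lerD // ler_norm.
Qed.

End FiniteGroupLaws.

Arguments uniform R H x : clear implicits.

Section WarpTransposeTop.
Context (R : realType) (gT : finGroupType) (n : nat).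

(* In the next two definitions l stands for the last position. *)
Definition warp_elt (l : 'I_n) (g : gT) : wreath gT n :=
  Wreath [ffun j => if j == l then g else 1%g] 1%g.

Definition warp_transpose_elt (l i : 'I_n) (g : gT) : wreath gT n :=
  Wreath [ffun j => if j == i then g^-1%g else if j == l then g else 1%g]
         (tperm i l).

(* Quantifying over l with l.+1 = n covers all n at once; there is no such l
   when n = 0, and exactly one otherwise. *)
Definition warp_transpose_support : {set wreath gT n} :=
  [set x | [exists l : 'I_n, (l.+1 == n) &&
     ([exists g, x == warp_elt l g] ||
      [exists i : 'I_n, (i < l)%N && [exists g, x == warp_transpose_elt l i g]])]].

Definition warp_transpose_top : wreath gT n -> R := fun x =>
  if x \in warp_transpose_support then (n%:R * #|gT|%:R)^-1 else 0.

End WarpTransposeTop.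

Arguments warp_transpose_support gT n : clear implicits.
Arguments warp_transpose_top R gT n x : clear implicits.

(* Main.v *)
(* For a permutation s write q_k(s) for the probability that the S_n-component of
   the walk is s at time k.

   Upper bound.  Given the positions i_1, ..., i_k selected by the walk, the group
   coordinates are exactly uniform as soon as every position (including n) has been
   selected: averaging coordinate n against a step (i, n) randomizes coordinate i
   as well.  Hence the distance to uniformity is at most the coupon collector error
   n (1 - 1/n)^k plus the distance of q_k from the uniform law of S_n.  The latter is
   bounded in L^2: n! q_2k(id) is the normalized trace of T^2k, where
   T = 1 + J_n with J_n = sum_(i < n) (i n) the last Jucys-Murphy element, and the number of
   eigenvalues of T of modulus > n - j - 1 is at most 2 n^(2j).  Indeed an eigenvalue
   c of J_n in a submodule of the regular representation can be pushed, using only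
   the relation s J_m s + s = J_(m+1), to a vector fixed by S_(m+1) with m >= c; such
   vectors do not exist among the functions orthogonal to all functions of j cards when
   m >= n - j - 1 (these form a submodule of codimension at most n^(2j)), and the bound
   from below follows by multiplying with the sign.  Altogether, with
   a = n exp(- k / n), the distance is at most 2 a.

   Lower bound.  Positions never selected are fixed points of the permutation.  Their
   number has mean mu = (n - 1) (1 - 1/n)^k and variance at most mu, while a uniform
   permutation has one fixed point on average. *)
From HB Require Import structures.
From mathcomp Require Import all_boot all_order all_fingroup all_algebra all_field.
From mathcomp Require Import spectral zify.

Set Implicit Arguments.
Unset Strict Implicit.
Unset Printing Implicit Defensive.

Import Order.TTheory GRing.Theory Num.Theory.

Local Open Scope ring_scope.

(** * Eigenvectors of Jucys-Murphy elements *)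

(** A restricted to the row space of V has an eigenvalue because the field is algebraically closed;
    [row_base V] carries the eigenvector back. *)
Lemma stable_eigenvector (C : numClosedFieldType) n (V A : 'M[C]_n) :
  stablemx V A -> V != 0 ->
  exists a, exists2 v : 'rV_n, v != 0 & (v <= V)%MS /\ v *m A = a *: v.
Proof.
move=> VA V0; have rV : (0 < \rank V)%N by rewrite lt0n mxrank_eq0.
have [a /eigenvalueP[v va v0]] := eigenvalue_closed (restrictmx V A) rV.
exists a, (v *m row_base V); first by rewrite mulmx_free_eq0 ?row_base_free.
have vV : (v *m row_base V <= V)%MS by rewrite mulmx_sub // eq_row_base.
split=> //; apply/eigenspaceP.
rewrite -sub_eigenspace_conjmx ?row_base_free ?stablemx_row_base //.
exact/eigenspaceP.
Qed.

Lemma row_normsq_eq0 (C : numClosedFieldType) n (v : 'rV[C]_n) :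
  v *m (map_mx Num.conj v)^T = 0 -> v = 0.
Proof.
move=> /matrixP/(_ 0 0); rewrite !mxE => /eqP; rewrite psumr_eq0; last first.
  by move=> i _; rewrite !mxE mul_conjC_ge0.
move=> /allP v0; apply/rowP => i; rewrite mxE; apply/eqP.
by have := v0 i (mem_index_enum _); rewrite !mxE mul_conjC_eq0.
Qed.

Section SymmetricMatrix.
Context (C : numClosedFieldType) (n : nat) (A : 'M[C]_n).
Hypothesis A_sym : A^T = A.
Hypothesis A_real : map_mx Num.conj A = A.

Lemma sym_eigenvalue_real (a : C) (v : 'rV_n) :
  v != 0 -> v *m A = a *: v -> a^* = a.
Proof.
move=> v0 va; have [//|ne] := eqVneq (a^*) a.
have e1 : A *m (map_mx Num.conj v)^T = a^* *: (map_mx Num.conj v)^T.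
  rewrite -[A in LHS]A_sym -trmx_mul -[in LHS]A_real -map_mxM va.
  by rewrite map_mxZ linearZ.
have : v *m A *m (map_mx Num.conj v)^T = v *m (A *m (map_mx Num.conj v)^T).
  by rewrite mulmxA.
rewrite va e1 -scalemxAl -scalemxAr => /eqP; rewrite -subr_eq0 -scalerBl.
rewrite scaler_eq0 subr_eq0 eq_sym (negbTE ne) /= => /eqP/row_normsq_eq0 v00.
by rewrite v00 eqxx in v0.
Qed.

(** No Jordan block of size two: w w^* = v (A - a) w^*, and A w^* = a w^* because A is real
    symmetric and a is real. *)
Lemma sym_eigen_semisimple (a : C) (v w : 'rV_n) :
  w = v *m A - a *: v -> w *m A = a *: w -> w = 0.
Proof.
move=> wE wa; have [//|w0] := eqVneq w 0; apply: row_normsq_eq0.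
have ra := sym_eigenvalue_real w0 wa.
have e1 : A *m (map_mx Num.conj w)^T = a *: (map_mx Num.conj w)^T.
  rewrite -[A in LHS]A_sym -trmx_mul -[in LHS]A_real -map_mxM wa.
  by rewrite map_mxZ linearZ /= ra.
by rewrite {1}wE mulmxBl -mulmxA e1 -scalemxAl -scalemxAr subrr.
Qed.

End SymmetricMatrix.

(** Induction on the number of moved points: composing s with (x, s x) makes s x a fixed point and
    keeps the old ones. *)
Lemma perm_on_tperm_invariant (T : finType) (V : Type) (act : V -> {perm T} -> V)
    (A : {set T}) (v : V) :
  (forall u s t, act u (s * t)%g = act (act u s) t) ->
  (forall u, act u 1%g = u) ->
  (forall i j, i \in A -> j \in A -> act v (tperm i j) = v) ->
  forall s, perm_on A s -> act v s = v.
Proof.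
move=> actM act1 At s; have [m] := ubnP #|[set x | s x != x]|.
elim: m s => // m IH s; rewrite ltnS => ms sA.
have [->//|s1] := eqVneq s 1%g.
have [x sx] : exists x, s x != x.
  apply/existsP; rewrite -negb_forall; apply: contra s1 => /forallP h.
  by apply/eqP/permP => x; rewrite perm1; apply/eqP.
have xA : x \in A by apply: (subsetP sA); rewrite inE.
have sxA : s x \in A by rewrite perm_closed.
pose t := (tperm x (s x) * s)%g.
have tA : perm_on A t.
  apply: perm_onM => //; apply: subset_trans (tperm_on _ _) _.
  by apply/subsetP => y; rewrite !inE => /orP[]/eqP->.
have -> : s = (tperm x (s x) * t)%g by rewrite /t mulgA tperm2 mul1g.
rewrite actM At // IH //; apply: leq_trans ms; apply: proper_card.
rewrite properE; apply/andP; split.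
  apply/subsetP => y; rewrite !inE; apply: contraNN => /eqP sy.
  rewrite /t permM tpermD ?sy //; first by apply: contraNneq sx => ->; rewrite sy.
  by apply: contraNneq sx => e; apply/eqP/(@perm_inj _ s); rewrite e sy.
apply/subsetPn; exists (s x); last by rewrite inE /t permM tpermR eqxx.
by rewrite inE (inj_eq perm_inj).
Qed.

Section JucysMurphy.
Context (C : numClosedFieldType) (n D : nat) (rho : 'S_n -> 'M[C]_D).
Hypothesis rho1 : rho 1%g = 1%:M.
Hypothesis rhoM : forall s t, rho (s * t)%g = rho s *m rho t.
Hypothesis rho_sym : forall i j, (rho (tperm i j))^T = rho (tperm i j).
Hypothesis rho_real : forall s, map_mx Num.conj (rho s) = rho s.
Context (U : 'M[C]_D).
Hypothesis rhoU : forall s, stablemx U (rho s).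

Definition jucys_murphy (j : 'I_n) : 'M[C]_D := \sum_(i : 'I_n | (i < j)%N) rho (tperm i j).
Local Notation J := jucys_murphy.

Lemma jucys_murphy_sym j : (J j)^T = J j.
Proof. by rewrite /J linear_sum; apply: eq_bigr => i _; rewrite /= rho_sym. Qed.

Lemma jucys_murphy_real j : map_mx Num.conj (J j) = J j.
Proof. by rewrite /J raddf_sum; apply: eq_bigr => i _; rewrite /= rho_real. Qed.

Lemma rho_tperm2 i j : rho (tperm i j) *m rho (tperm i j) = 1%:M.
Proof. by rewrite -rhoM tperm2 rho1. Qed.

Lemma jucys_murphy_stable j : stablemx U (J j).
Proof. by rewrite mulmx_sumr summx_sub // => i _; apply: rhoU. Qed.

(** Conjugation by (a b) permutes the terms (i j) of [J j] among themselves. *)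
Lemma jucys_murphy_comm (j a b : 'I_n) : (a < j)%N -> (b < j)%N ->
  J j *m rho (tperm a b) = rho (tperm a b) *m J j.
Proof.
move=> aj bj; rewrite /J mulmx_suml mulmx_sumr.
have tb : involutive (tperm a b) by exact: tpermK.
rewrite (reindex_inj (inv_inj tb)) /=; apply: eq_big => [i|i _].
  by case: tpermP => [->|->|_ _]; rewrite ?aj ?bj.
rewrite -!rhoM; congr rho; rewrite conjgC tpermJ tpermK; congr (_ * tperm _ _)%g.
by apply: tpermD; rewrite -val_eqE /= neq_ltn ?aj ?bj.
Qed.

(* The degenerate affine Hecke relation J_(m+1) = s J_m s + s with s = (m, m+1). *)
Lemma jucys_murphyS (j j1 : 'I_n) : j1 = j.+1 :> nat ->
  J j1 = rho (tperm j j1) *m J j *m rho (tperm j j1) + rho (tperm j j1).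
Proof.
move=> jE; rewrite {1}/J (bigD1 j) /=; last by rewrite jE.
rewrite addrC; congr (_ + _); rewrite /J mulmx_sumr mulmx_suml.
apply: eq_big => [i|i /andP[]].
  by rewrite jE ltnS [RHS]ltn_neqAle andbC.
rewrite jE ltnS => ij ne; rewrite -!rhoM; congr rho.
rewrite -[X in (X * _ * _)%g]tpermV -mulgA -conjgE tpermJ tpermL tpermD //.
  by rewrite eq_sym.
by rewrite -val_eqE /= neq_ltn jE !ltnS ij orbT.
Qed.

(* Let E be the c-eigenspace of J_(m+1) in U and s = (m, m+1).  If u in E satisfies
   u J_m = a u, then J_m has the eigenvector u when a = c, u again (for c + 1) when
   u s = - u, and u s + u / (a - c) (for c) otherwise, unless u s = u.  When only this
   last case occurs, J_m is the scalar c - 1 on E by semisimplicity, so E is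
   fixed by s, hence by all the permutations of 0, ..., m + 1.  The index m + 1 of
   J is the number of its terms since positions start from 0. *)
Lemma jucys_murphy_eigenvector m (j : 'I_n) : j = m :> nat ->
  forall (c : C) (v : 'rV_D), v != 0 -> (v <= U)%MS -> v *m J j = c *: v ->
  exists (k : nat) (r : 'I_n), c + k%:R = r%:R /\
    exists2 w : 'rV_D, w != 0 & (w <= U)%MS /\
      forall s, perm_on [set i : 'I_n | (i <= r)%N] s -> w *m rho s = w.
Proof.
elim: m j => [|m IH] j jE c v v0 vU vc.
  (* Here [J j] is an empty sum, so c = 0, and a permutation of the single position 0 is trivial. *)
  exists 0%N, j; split.
    move/eqP: vc; rewrite /J big_pred0; last by move=> i; rewrite jE.
    rewrite mulmx0 eq_sym scaler_eq0 (negbTE v0) orbF => /eqP->.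
    by rewrite jE addr0.
  exists v => //; split=> // s /perm_on_id -> //; first by rewrite rho1 mulmx1.
  rewrite jE; apply/card_le1P => i; rewrite inE leqn0 => /eqP i0 i'.
  by rewrite !inE leqn0 -i0 -val_eqE.
have jlt : (m < n)%N by rewrite -ltnS -jE ltnS ltnW.
pose i := Ordinal jlt; have ijE : j = i.+1 :> nat by rewrite jE.
pose s := rho (tperm i j); have ss : s *m s = 1%:M := rho_tperm2 _ _.
have sJE : s *m J i = J j *m s - 1%:M.
  by rewrite (jucys_murphyS ijE) -/s mulmxDl -!mulmxA ss mulmx1 addrK.
pose E := (U :&: eigenspace (J j) c)%MS.
have EP (u : 'rV_D) : reflect ((u <= U)%MS /\ u *m J j = c *: u) (u <= E)%MS.
  rewrite sub_capmx; apply: (iffP andP) => -[? ?]; split=> //; exact/eigenspaceP.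
have vE : (v <= E)%MS by apply/EP.
have subU (u : 'rV_D) M : stablemx U M -> (u <= U)%MS -> (u *m M <= U)%MS.
  by move=> UM uU; apply: submx_trans UM; apply: submxMr.
have E_stable M : stablemx U M -> J j *m M = M *m J j -> stablemx E M.
  move=> UM JM; apply/rV_subP => w /submxP[u ->]; rewrite mulmxA.
  have /EP[uU uc] := submxMl u E.
  apply/EP; split; first exact: subU UM uU.
  by rewrite -[LHS]mulmxA -JM mulmxA uc -scalemxAl.
have JJ : J j *m J i = J i *m J j.
  have h := @jucys_murphy_comm j.
  rewrite [J i]/J mulmx_sumr [RHS]mulmx_suml; apply: eq_bigr => a ai.
  by rewrite h ?ijE // ltnS // ltnW.
have E_Ji : stablemx E (J i) by apply: E_stable => //; exact: jucys_murphy_stable.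
(* The term u / (a - c) cancels the inhomogeneous part of [sJE], so the eigenvalue c passes from
   [J j] to [J i]. *)
have v_s (u : 'rV_D) a : (u <= E)%MS -> u *m J i = a *: u -> a != c ->
    (u *m s + (a - c)^-1 *: u) *m J i = c *: (u *m s + (a - c)^-1 *: u).
  move=> /EP[uU uc] ua ac.
  rewrite mulmxDl -mulmxA sJE mulmxBr mulmxA uc mulmx1 -!scalemxAl ua.
  rewrite scalerDr -addrA; congr (_ + _).
  rewrite !scalerA -{1}[u]scale1r -scaleNr -scalerDl; congr (_ *: _).
  by rewrite -{1}(@mulVf _ (a - c)) ?subr_eq0 // -mulrN -mulrDr opprB subrK mulrC.
have step (u : 'rV_D) a : u != 0 -> (u <= E)%MS -> u *m J i = a *: u ->
    (exists k, exists2 w : 'rV_D, w != 0 & (w <= U)%MS /\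
       w *m J i = (c + k%:R) *: w) \/ (a = c - 1 /\ u *m s = u).
  move=> u0 uE ua; have /EP[uU uc] := uE.
  have [ac|ac] := eqVneq a c.
    by left; exists 0%N, u => //; rewrite addr0 -ac.
  pose w := u *m s + (a - c)^-1 *: u.
  have [w0|w0] := eqVneq w 0; last first.
    left; exists 0%N, w => //; rewrite addr0; split; last exact: v_s.
    by rewrite addmx_sub ?scalemx_sub //; exact: subU (rhoU _) uU.
  have us : u *m s = - (a - c)^-1 *: u.
    by apply/eqP; rewrite scaleNr -addr_eq0; apply/eqP.
  (* Now s acts on u by a scalar; as s is an involution, a - c is 1 or -1. *)
  have : (a - c)^-1 ^+ 2 == 1.
    have : u *m s *m s = (a - c)^-1 ^+ 2 *: u.
      by rewrite us -scalemxAl us scalerA mulrNN.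
    rewrite -mulmxA ss mulmx1 -{1}[u]scale1r => /eqP.
    by rewrite -subr_eq0 -scalerBl scaler_eq0 (negbTE u0) orbF subr_eq0 eq_sym.
  rewrite sqrf_eq1 => /orP[]/eqP e.
    left; exists 1%N, u => //; split=> //; rewrite ua.
    by rewrite -[a](subrK c) -[a - c]invrK e invr1 addrC.
  right; split; last by rewrite us e opprK scale1r.
  by rewrite -[a](subrK c) -[a - c]invrK e invrN invr1 addrC.
have jw k (w : 'rV_D) : w != 0 -> (w <= U)%MS -> w *m J i = (c + k%:R) *: w ->
    exists (k : nat) (r : 'I_n), c + k%:R = r%:R /\
    exists2 w : 'rV_D, w != 0 & (w <= U)%MS /\
      forall s, perm_on [set i : 'I_n | (i <= r)%N] s -> w *m rho s = w.
  move=> w0 wU wc; have [k' [r [e P]]] := IH i erefl _ _ w0 wU wc.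
  by exists (k + k')%N, r; rewrite natrD addrA.
pose N := J i - (c - 1)%:M.
have uN (u : 'rV_D) : u *m N = u *m J i - (c - 1) *: u.
  by rewrite mulmxBr mul_mx_scalar.
(* An eigenvector of [J i] in the image of N cannot have eigenvalue c - 1, by semisimplicity, so
   [step] supplies a vector for the induction. *)
have [EN0|EN0] := eqVneq (E *m N) 0; last first.
  have ENJ : stablemx <<E *m N>>%MS (J i).
    rewrite (eqmx_stable _ (genmxE _)) -mulmxA.
    have -> : N *m J i = J i *m N.
      by rewrite mulmxBl mulmxBr scalar_mxC.
    by rewrite mulmxA submxMr.
  have EN0' : <<E *m N>>%MS != 0.
    by rewrite -mxrank_eq0 genmxE mxrank_eq0.
  have [a [w w0 [wEN wa]]] := stable_eigenvector ENJ EN0'.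
  have /submxP[x xE] : (w <= E *m N)%MS by rewrite -(genmxE (E *m N)).
  have wE : (w <= E)%MS.
    rewrite xE mulmxA; apply: submx_trans (submxMr _ (submxMl x E)) _.
    rewrite mulmxBr addmx_sub // mul_mx_scalar -scaleNr.
    exact: scalemx_sub.
  have [[k [u u0 [uU uc]]]|[ac _]] := step w a w0 wE wa; first exact: jw u0 uU uc.
  case/eqP: w0; have := @sym_eigen_semisimple _ _ (J i) _ _ (c - 1) (x *m E) w.
  apply; rewrite ?jucys_murphy_sym ?jucys_murphy_real ?wa ?ac //.
  by rewrite -uN xE mulmxA.
have E_s (u : 'rV_D) : (u <= E)%MS ->
    (exists k, exists2 w : 'rV_D, w != 0 & (w <= U)%MS /\
       w *m J i = (c + k%:R) *: w) \/ u *m s = u.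
  move=> uE; have [->|u0] := eqVneq u 0; first by right; rewrite mul0mx.
  have ua : u *m J i = (c - 1) *: u.
    apply/eqP; rewrite -subr_eq0 -uN; have /submxP[x ->] := uE.
    by rewrite -mulmxA EN0 mulmx0.
  by have [|[_ ?]] := step u _ u0 uE ua; [left | right].
have [[k [u u0 [uU uc]]]|vs] := E_s v vE; first exact: jw u0 uU uc.
(* For a below i, (a j) is the conjugate of (i j) by (a i), and (a i) commutes with [J j], hence
   preserves E. *)
have tail (a : 'I_n) : (a < j)%N ->
    (exists k, exists2 w : 'rV_D, w != 0 & (w <= U)%MS /\
       w *m J i = (c + k%:R) *: w) \/ v *m rho (tperm a j) = v.
  rewrite ijE ltnS leq_eqVlt => /orP[/eqP/val_inj->|ai]; first by right.
  have ne : a != i by rewrite -val_eqE /= neq_ltn ai.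
  have vaE : (v *m rho (tperm a i) <= E)%MS.
    apply: submx_trans (submxMr _ vE) _; apply: E_stable => //.
    by apply: jucys_murphy_comm; rewrite ijE ltnS // ltnW.
  have [|vas] := E_s _ vaE; [by left | right].
  have -> : tperm a j = (tperm a i * tperm i j * tperm a i)%g.
    rewrite -[X in (X * _ * _)%g]tpermV -mulgA -conjgE tpermJ tpermR tpermD //.
      by rewrite -val_eqE /= neq_ltn ijE ltnS ltnW.
    by rewrite -val_eqE /= neq_ltn ijE ltnS leqnn.
  by rewrite !rhoM !mulmxA vas -mulmxA rho_tperm2 mulmx1.
have [[k [u u0 [uU uc]]]|all_tail] : (exists k, exists2 w : 'rV_D, w != 0 &
    (w <= U)%MS /\ w *m J i = (c + k%:R) *: w) \/
    forall a : 'I_n, (a < j)%N -> v *m rho (tperm a j) = v.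
- have [/forallP h|] := boolP [forall a : 'I_n, (a < j)%N ==> (v *m rho (tperm a j) == v)].
    by right=> a aj; apply/eqP; exact: implyP (h a) aj.
  rewrite negb_forall => /existsP[a]; rewrite negb_imply => /andP[aj /eqP ne].
  by have [|//] := tail a aj; left.
- exact: jw u0 uU uc.
exists 0%N, j; split.
  (* All the j terms of [J j] fix v, which forces c = j. *)
  move/eqP: vc; rewrite /J mulmx_sumr (eq_bigr (fun=> v)) => [|a /all_tail //].
  rewrite -(big_ord_widen n (fun=> v)) ?(ltnW (ltn_ord j)) // sumr_const card_ord.
  rewrite -scaler_nat -subr_eq0 -scalerBl scaler_eq0 (negbTE v0) orbF.
  by rewrite subr_eq0 addr0 eq_sym => /eqP.
exists v => //; split=> // t.
apply: (@perm_on_tperm_invariant _ _ (fun u t => u *m rho t)).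
- by move=> u t1 t2; rewrite rhoM mulmxA.
- by move=> u; rewrite rho1 mulmx1.
move=> a b; rewrite !inE.
have [->|ab] := eqVneq a b; first by rewrite tperm1 rho1 mulmx1.
have [-> _|aj] := eqVneq a j.
  by rewrite leq_eqVlt val_eqE tpermC => /orP[/eqP->|/all_tail//]; rewrite tperm1 rho1 mulmx1.
have [->|bj] := eqVneq b j.
  by rewrite leq_eqVlt val_eqE (negbTE aj) => /all_tail.
rewrite (leq_eqVlt a) (leq_eqVlt b) !val_eqE (negbTE aj) (negbTE bj) /=.
move=> /all_tail va /all_tail vb.
have -> : tperm a b = (tperm a j * tperm b j * tperm a j)%g.
  rewrite -[X in (X * _ * _)%g]tpermV -mulgA -conjgE tpermJ tpermR (tpermD ab) 1?eq_sym //.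
  exact: tpermC.
by rewrite !rhoM !mulmxA va vb va.
Qed.

End JucysMurphy.

(** * Counting closed walks on the star-transposition graph *)

(* A span of more than N eigenvectors meets the kernel of K in a stable subspace. *)
Lemma card_eigenvalues_le (C : numClosedFieldType) D N (P T : 'M[C]_D)
    (d : 'rV[C]_D) (K : 'M[C]_(D, N)) (S : {set 'I_D}) :
  P \in unitmx -> P *m T = diag_mx d *m P -> stablemx (kermx K) T ->
  (forall mu (v : 'rV_D), v != 0 -> v *m K = 0 -> v *m T = mu *: v ->
     forall i, i \in S -> d 0 i != mu) ->
  (#|S| <= N)%N.
Proof.
move=> Pu PT KT dS; rewrite leqNgt; apply/negP => NS.
pose f (i : 'I_#|S|) : 'I_D := enum_val i.
pose W := rowsub f P; pose e : 'rV[C]_#|S| := \row_i d 0 (f i).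
have WT : W *m T = diag_mx e *m W.
  rewrite /W mul_rowsub_mx PT; apply/matrixP => i j.
  by rewrite mxE !mul_diag_mx !mxE.
have Wfree (u : 'rV_#|S|) : u *m W = 0 -> u = 0.
  have -> : u *m W = (\row_j \sum_(i | f i == j) u 0 i) *m P.
    apply/rowP => j; rewrite !mxE.
    under [RHS]eq_bigr => i _ do rewrite mxE mulr_suml.
    rewrite (exchange_big_dep xpredT) //=; apply: eq_bigr => i _.
    by rewrite (big_pred1 (f i)) ?mxE // => k; rewrite eq_sym.
  move/(congr1 (mulmx^~ (invmx P))); rewrite mulmxK // mul0mx => /rowP u0.
  apply/rowP => i; have := u0 (f i); rewrite !mxE (big_pred1 i) // => k.
  by rewrite /f (inj_eq enum_val_inj).
(* W has more rows than K has columns, so some combination of the rows of W is killed by K. *)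
have V0 : (W :&: kermx K)%MS != 0.
  have : kermx (W *m K) != 0.
    rewrite kermx_eq0 /row_free neq_ltn.
    by rewrite (leq_ltn_trans (rank_leq_col _)).
  case/rowV0Pn => u /sub_kermxP; rewrite mulmxA => uWK u0.
  apply/rowV0Pn; exists (u *m W); last by apply: contra_neq u0; apply: Wfree.
  by rewrite sub_capmx submxMl; apply/sub_kermxP.
have VT : stablemx (W :&: kermx K)%MS T.
  rewrite sub_capmx; apply/andP; split.
    apply: submx_trans (submxMr _ (capmxSl _ _)) _.
    by rewrite WT submxMl.
  by apply: submx_trans KT; apply: submxMr; apply: capmxSr.
have [mu [v v0 [vV vT]]] := stable_eigenvector VT V0.
move: vV; rewrite sub_capmx => /andP[/submxP[u uE] /sub_kermxP vK].
have dmu := dS mu v v0 vK vT.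
(* The eigenvector v is a combination of independent eigenvectors whose eigenvalues all differ from
   mu, so its coefficients vanish. *)
have : (u *m diag_mx e - mu *: u) *m W = 0.
  rewrite mulmxBl -mulmxA -WT mulmxA -uE vT -scalemxAl -uE; exact: subrr.
move/Wfree/rowP => ud; case/eqP: v0; rewrite uE.
suff -> : u = 0 by rewrite mul0mx.
apply/rowP => i; have /eqP := ud i; rewrite mul_mx_diag !mxE mulrC -mulrBl mulf_eq0.
by rewrite subr_eq0 (negbTE (dmu _ (enum_valP i))) => /eqP.
Qed.

(* Counts the words of length m in the star transpositions with product y, the
   letter i = l standing for the identity. *)
Fixpoint star_walks n (l : 'I_n) (m : nat) (y : 'S_n) : nat :=
  if m is m'.+1 then (\sum_i star_walks l m' (y * tperm i l)%g)%N else (y == 1%g).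

Section RegularRepresentation.
Context (n : nat).
Local Notation D := #|{: 'S_n}|.

(** Right regular representation on row vectors: the basis vector of x goes to that of x * s, so s
    acts on the values of x, read as positions of cards. *)
Definition regular_perm_mx (s : 'S_n) : 'M[algC]_D :=
  \matrix_(x, y) (enum_val y == enum_val x * s)%g%:R.
Local Notation rho := regular_perm_mx.

Lemma mul_regular_perm_mx m (A : 'M[algC]_(m, D)) s i y :
  (A *m rho s) i y = A i (enum_rank (enum_val y * s^-1)%g).
Proof.
rewrite mxE (bigD1 (enum_rank (enum_val y * s^-1)%g)) //= mxE enum_rankK.
rewrite mulgKV eqxx mulr1 big1 ?addr0 // => x; rewrite -(inj_eq enum_val_inj).
rewrite enum_rankK mxE => ne; rewrite (negbTE (_ : enum_val y != _)%g) ?mulr0 //.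
by apply: contraNneq ne => ->; rewrite mulgK.
Qed.

Lemma regular_perm_mx1 : rho 1%g = 1%:M.
Proof. by apply/matrixP => x y; rewrite !mxE mulg1 (inj_eq enum_val_inj) eq_sym. Qed.

Lemma regular_perm_mxM s t : rho (s * t)%g = rho s *m rho t.
Proof.
apply/matrixP => x y; rewrite mul_regular_perm_mx !mxE enum_rankK mulgA.
by rewrite -(inj_eq (mulIg t^-1%g)) !mulgK.
Qed.

Lemma regular_perm_mx_sym i j : (rho (tperm i j))^T = rho (tperm i j).
Proof.
apply/matrixP => x y; rewrite !mxE -(inj_eq (mulIg (tperm i j)^-1%g)) mulgK tpermV.
by rewrite eq_sym.
Qed.

Lemma regular_perm_mx_real s : map_mx Num.conj (rho s) = rho s.
Proof. by apply/matrixP => x y; rewrite !mxE rmorph_nat. Qed.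

Definition pattern j := ({ffun 'I_j -> 'I_n} * {ffun 'I_j -> 'I_n})%type.

(* The kernel consists of the functions on S_n orthogonal to all those which depend
   only on the positions of j cards. *)
Definition junta_mx (j : nat) : 'M[algC]_(D, #|{: pattern j}|) :=
  \matrix_(x, ab) [forall t, (enum_val x : 'S_n) ((enum_val ab : pattern j).1 t) ==
                              (enum_val ab : pattern j).2 t]%:R.

(** Testing [v *m rho s] against the pattern (a, b) amounts to testing v against (a, s^-1 b). *)
Lemma junta_mx_stable j s : stablemx (kermx (junta_mx j)) (rho s).
Proof.
apply/rV_subP => w /submxP[u ->]; rewrite mulmxA.
have /sub_kermxP := submxMl u (kermx (junta_mx j)).
move: (u *m _) => {u w}v v0; apply/sub_kermxP/rowP => ab.
pose ab' : pattern j :=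
  ((enum_val ab : pattern j).1, [ffun t => s^-1%g ((enum_val ab : pattern j).2 t)]).
have /rowP/(_ (enum_rank ab')) := v0.
rewrite !mxE => vab; rewrite -[RHS]vab.
pose h (x : 'I_D) := enum_rank (enum_val x * s)%g.
have hK : cancel h (fun y => enum_rank (enum_val y * s^-1)%g).
  by move=> x; rewrite /h enum_rankK mulgK enum_valK.
rewrite (reindex_inj (can_inj hK)); apply: eq_bigr => x _.
rewrite mul_regular_perm_mx enum_rankK mulgK enum_valK !mxE !enum_rankK /=.
congr (_ * (nat_of_bool _)%:R); apply: eq_forallb => t.
by rewrite ffunE permM -[RHS](inj_eq (@perm_inj _ s)) permKV.
Qed.

(** The pattern [ab] freezes the cards that y puts on the last j positions. A matching x differs
    from y by a permutation of the positions up to r, so w takes the same value at x and y; the sum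
    of w over the matches, y among them, vanishes. *)
Lemma junta_mx_invariant_eq0 j (r : nat) (w : 'rV_D) : (0 < n)%N -> (n <= r + j + 1)%N ->
  w *m junta_mx j = 0 ->
  (forall s : 'S_n, perm_on [set i : 'I_n | (i <= r)%N] s -> w *m rho s = w) -> w = 0.
Proof.
move=> n_gt0 nrj wK ws; apply/rowP => y; rewrite mxE; pose y0 : 'S_n := enum_val y.
have tail_lt (t : 'I_j) : (0 < n)%N -> (n.-1 - t < n)%N.
  by case: (n) => // m _; rewrite ltnS leq_subr.
pose tl (t : 'I_j) : 'I_n := Ordinal (tail_lt t n_gt0).
pose ab := ([ffun t => y0^-1%g (tl t)], [ffun t => tl t]) : pattern j.
have /rowP/(_ (enum_rank ab)) := wK; rewrite !mxE.
under eq_bigr => x _.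
  rewrite mxE enum_rankK /=.
  have -> : w 0 x * [forall t, (enum_val x : 'S_n) (ab.1 t) == ab.2 t]%:R =
            w 0 y *+ [forall t, (enum_val x : 'S_n) (ab.1 t) == ab.2 t].
    case: forallP => [xab|_]; last by rewrite mulr0 mulr0n.
    rewrite mulr1 mulr1n; pose s := (y0^-1 * enum_val x)%g.
    have /ws/rowP/(_ x) : perm_on [set i : 'I_n | (i <= r)%N] s.
      apply/subsetP => i; rewrite !inE; apply: contraNT; rewrite -ltnNge => ri.
      have ij : (n.-1 - i < j)%N.
        by have := ltn_ord i; lia.
      have iE : tl (Ordinal ij) = i by apply/val_inj; rewrite /=; have := ltn_ord i; lia.
      by have := xab (Ordinal ij); rewrite !ffunE iE permM.
    rewrite mul_regular_perm_mx /s invMg invgK mulgA mulgV mul1g /y0 enum_valK.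
    by move=> ->.
  over.
rewrite sumrMnr => /eqP; rewrite mulrn_eq0 => /orP[|/eqP//].
rewrite sum_nat_eq0 => /forallP/(_ y); rewrite /= eqb0.
by case: forallP => // -[] t; rewrite !ffunE permKV.
Qed.

End RegularRepresentation.

Section StarTransposition.
Context (n : nat) (l : 'I_n).
Hypothesis l_last : l.+1 = n.
Local Notation D := #|{: 'S_n}|.
Local Notation rho := (@regular_perm_mx n).
Local Notation J := (jucys_murphy rho l).
Local Notation K := (junta_mx n).

Let n_gt0 : (0 < n)%N. Proof. by rewrite -l_last. Qed.

Definition sign_mx : 'M[algC]_D := diag_mx (\row_x (-1) ^+ odd_perm (enum_val x : 'S_n)).

(** Every term of J is an odd permutation; hence multiplication by the sign turns the eigenvalue c
    into - c. *)
Lemma sign_mx_jucys_murphy : sign_mx *m J = - (J *m sign_mx).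
Proof.
rewrite /jucys_murphy mulmx_sumr [in RHS]mulmx_suml -sumrN; apply: eq_bigr => i il.
apply/matrixP => x y; rewrite mul_diag_mx mul_mx_diag !mxE.
have [->|] := eqVneq (enum_val y) _; last by rewrite mulr0 mul0r oppr0.
by rewrite mulr1 mul1r odd_permM odd_tperm -val_eqE /= neq_ltn il signr_addb mulrN1 opprK.
Qed.

Lemma sign_mxK : sign_mx *m sign_mx = 1%:M.
Proof.
apply/matrixP => x y; rewrite mul_diag_mx !mxE.
by case: eqVneq => [->|_]; rewrite ?mulr0 // mulr1n -expr2 sqrr_sign.
Qed.

(** The conclusion says that c is an integer at most n - 1, in a form that needs no order on
    [algC]. *)
Lemma jucys_murphy_eigenvalue_lt (c : algC) (v : 'rV_D) : v != 0 -> v *m J = c *: v ->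
  exists k r : nat, c + k%:R = r%:R /\ (r < n)%N.
Proof.
move=> v0 vc.
have [] := @jucys_murphy_eigenvector _ _ _ rho (regular_perm_mx1 n)
  (@regular_perm_mxM n) (@regular_perm_mx_sym n) (@regular_perm_mx_real n)
  1%:M (fun _ => submx1 _) l l erefl c v v0 (submx1 _) vc.
by move=> k [r [e _]]; exists k, r.
Qed.

Lemma jucys_murphy_eigenvalue_junta j (c : algC) (v : 'rV_D) : v != 0 -> v *m K j = 0 ->
  v *m J = c *: v -> exists k r : nat, c + k%:R = r%:R /\ (r + j + 1 < n)%N.
Proof.
move=> v0 vK vc; have vU : (v <= kermx (K j))%MS by exact/sub_kermxP.
have [] := @jucys_murphy_eigenvector _ _ _ rho (regular_perm_mx1 n)
  (@regular_perm_mxM n) (@regular_perm_mx_sym n) (@regular_perm_mx_real n)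
  _ (@junta_mx_stable n j) l l erefl c v v0 vU vc.
move=> k [r [e [w w0 [/sub_kermxP wK wr]]]]; exists k, r; split=> //.
rewrite ltnNge; apply: contra w0 => nr; apply/eqP.
exact: junta_mx_invariant_eq0 nr wK wr.
Qed.

Lemma sign_mx_eigenvector (c : algC) (v : 'rV_D) : v != 0 -> v *m J = c *: v ->
  v *m sign_mx != 0 /\ v *m sign_mx *m J = - c *: (v *m sign_mx).
Proof.
move=> v0 vc; split; last first.
  by rewrite -mulmxA sign_mx_jucys_murphy mulmxN mulmxA vc scaleNr scalemxAl.
by apply: contra_neq v0 => v0; rewrite -[v]mulmx1 -sign_mxK mulmxA v0 mul0mx.
Qed.

(** The first equation bounds c above, the second bounds it below; the summand 1 in 1 + c makes the
    two conditions on r and r' differ by two. *)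
Lemma eigenvalue_bound (m : nat) (c : algC) (k k' r r' : nat) :
  c + k%:R = r%:R -> - c + k'%:R = r'%:R -> (r < m)%N -> (r' <= m.+1)%N ->
  1 + c \is Num.real /\ `|1 + c| <= m%:R.
Proof.
move=> cr cr' rm rm'; have cE : c = r%:R - k%:R by rewrite -cr addrK.
have cE' : c = k'%:R - r'%:R.
  by apply: oppr_inj; rewrite opprB -cr' addrK.
have c_real : 1 + c \is Num.real by rewrite cE !(rpredD, rpredN, rpred_nat, rpred1).
split=> //; rewrite real_ler_norml //; apply/andP; split.
  have -> : - m%:R = 1 - m.+1%:R :> algC by rewrite -natr1 opprD addrCA subrr addr0.
  by rewrite lerD2l cE' addrC ler_wpDr ?ler0n // lerN2 ler_nat.
by rewrite cE addrA lerBlDr nat1r -natrD ler_nat (leq_trans rm) // leq_addr.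
Qed.

Definition star_mx : 'M[algC]_D := 1%:M + J.
Local Notation T := star_mx.

Lemma star_mx_eigenE (mu : algC) (v : 'rV_D) : v *m T = mu *: v -> v *m J = (mu - 1) *: v.
Proof. by rewrite mulmxDr mulmx1 scalerBl scale1r => <-; rewrite addrC addKr. Qed.

Lemma star_mx_normal : T \is normalmx.
Proof.
have Tt : T^T = T.
  by rewrite linearD /= trmx1 jucys_murphy_sym //; exact: regular_perm_mx_sym.
have Tr : map_mx Num.conj T = T.
  by rewrite map_mxD map_mx1 jucys_murphy_real //; exact: regular_perm_mx_real.
by apply/normalmxP; rewrite Tt Tr.
Qed.

Let P := spectralmx T.
Let d := spectral_diag T.

Lemma star_mx_diag : P *m T = diag_mx d *m P.
Proof.
have /orthomx_spectralP TE := star_mx_normal.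
by rewrite [in LHS]TE -/P -/d -mulmxA mulKVmx ?spectral_unit.
Qed.

Lemma spectral_row_eigen i : row i P != 0 /\ row i P *m T = d 0 i *: row i P.
Proof.
split; last first.
  by rewrite -row_mul star_mx_diag; apply/rowP => j; rewrite mul_diag_mx !mxE.
apply/eqP => Pi; have /matrixP/(_ i i) := mulmxV (spectral_unit T).
rewrite -/P mxE big1 ?mxE ?eqxx; first by move/eqP; rewrite eq_sym oner_eq0.
by move=> j _; have /rowP/(_ j) := Pi; rewrite !mxE => ->; rewrite mul0r.
Qed.

Lemma star_eigenvalue_le i : d 0 i \is Num.real /\ `|d 0 i| <= n%:R.
Proof.
have [v0 /star_mx_eigenE vJ] := spectral_row_eigen i.
have [v0' vJ'] := sign_mx_eigenvector v0 vJ.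
have [k [r [e rn]]] := jucys_murphy_eigenvalue_lt v0 vJ.
have [k' [r' [e' rn']]] := jucys_murphy_eigenvalue_lt v0' vJ'.
by have := eigenvalue_bound e e' rn (leqW (ltnW rn')); rewrite addrC subrK.
Qed.

Lemma star_stable j : stablemx (kermx (K j)) T.
Proof.
rewrite mulmxDr mulmx1 addmx_sub //.
apply: jucys_murphy_stable => s; exact: junta_mx_stable.
Qed.

(** The only pattern is the empty one, which asks for sum zero. The lower bound is already given by
    r' < n, so no sign-twisted constraint is imposed and the count is 1. *)
Lemma card_star_eigenvalues1 : (#|[set i : 'I_D | (n.-1)%:R < `|d 0 i|]%R| <= 1)%N.
Proof.
apply: (@leq_trans #|{: pattern n 0}|).
  2: by rewrite card_prod !card_ffun !card_ord expn0.
apply: (card_eigenvalues_le (spectral_unit T) star_mx_diag (star_stable 0)).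
move=> mu v v0 vK vT i; rewrite inE; apply: contraTneq => ->.
have vJ := star_mx_eigenE vT; have [v0' vJ'] := sign_mx_eigenvector v0 vJ.
have [k [r [e rn]]] := jucys_murphy_eigenvalue_junta v0 vK vJ.
have [k' [r' [e' rn']]] := jucys_murphy_eigenvalue_lt v0' vJ'.
have := @eigenvalue_bound n.-1 _ _ _ _ _ e e'; rewrite addrC subrK.
by case; [lia | lia |] => mr le; rewrite -real_leNgt ?realn // normr_real.
Qed.

(** Orthogonality to functions of j cards is imposed on v, for the upper bound, and on its sign
    twist, for the lower bound; hence the factor 2. *)
Lemma card_star_eigenvalues j : (0 < j < n)%N ->
  (#|[set i : 'I_D | (n - j - 1)%:R < `|d 0 i|]%R| <= 2 * n ^ j.*2)%N.
Proof.
move=> /andP[j0 jn].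
have -> : (2 * n ^ j.*2 = #|{: pattern n j}| + #|{: pattern n j}|)%N.
  by rewrite card_prod !card_ffun !card_ord -expnD addnn addnn mul2n.
have kP v : reflect (v *m K j = 0 /\ v *m sign_mx *m K j = 0)
    (v <= kermx (row_mx (K j) (sign_mx *m K j)))%MS.
  apply: (iffP sub_kermxP); rewrite mul_mx_row mulmxA.
    by move/eqP; rewrite row_mx_eq0 => /andP[/eqP ? /eqP ?].
  by case=> -> ->; rewrite row_mx0.
apply: (card_eigenvalues_le (K := row_mx (K j) (sign_mx *m K j))
   (spectral_unit T) star_mx_diag).
  apply/rV_subP => w /submxP[u ->]; rewrite mulmxA.
  have /kP := submxMl u (kermx (row_mx (K j) (sign_mx *m K j))).
  move: (u *m _) => {u w} v [vK vsK]; apply/kP.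
  have st A (w : 'rV_D) : w *m K j = 0 -> stablemx (kermx (K j)) A -> w *m A *m K j = 0.
    move=> wK /(submx_trans _) KA; apply/sub_kermxP; apply: KA; apply: submxMr.
    exact/sub_kermxP.
  split; first exact: st (star_stable j).
  rewrite -[v *m T *m _]mulmxA /T mulmxDl mul1mx -[J *m _]opprK -sign_mx_jucys_murphy.
  rewrite mulmxBr mulmxBl vsK sub0r mulmxA st ?oppr0 //.
  by apply: jucys_murphy_stable => s; exact: junta_mx_stable.
move=> mu v v0 /sub_kermxP/kP[vK vsK] vT i; rewrite inE; apply: contraTneq => ->.
have vJ := star_mx_eigenE vT; have [v0' vJ'] := sign_mx_eigenvector v0 vJ.
have [k [r [e rn]]] := jucys_murphy_eigenvalue_junta v0 vK vJ.
have [k' [r' [e' rn']]] := jucys_murphy_eigenvalue_junta v0' vsK vJ'.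
have := @eigenvalue_bound (n - j - 1) _ _ _ _ _ e e'; rewrite addrC subrK.
by case; [lia | lia |] => mr le; rewrite -real_leNgt ?realn // normr_real.
Qed.

(** This is the m-th power of [star_mx]. *)
Definition walk_mx m : 'M[algC]_D :=
  \matrix_(x, y) (star_walks l m ((enum_val x)^-1 * enum_val y)%g)%:R.

Lemma star_mxE : T = \sum_i rho (tperm i l).
Proof.
rewrite (bigD1 l) //= tperm1 regular_perm_mx1; congr (_ + _); apply: eq_bigl => i.
by rewrite ltn_neqAle -ltnS l_last ltn_ord andbT.
Qed.

Lemma walk_mxS m : walk_mx m.+1 = walk_mx m *m T.
Proof.
rewrite star_mxE mulmx_sumr; apply/matrixP => x y; rewrite summxE mxE natr_sum.
apply: eq_bigr => i _; rewrite mul_regular_perm_mx !mxE enum_rankK tpermV.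
by rewrite mulgA.
Qed.

Lemma spectral_walk_mx m : P *m walk_mx m = diag_mx (map_mx (fun x => x ^+ m) d) *m P.
Proof.
elim: m => [|m IH].
  have -> : walk_mx 0 = 1%:M.
    apply/matrixP => x y; by rewrite !mxE /= -eq_mulVg1 (inj_eq enum_val_inj).
  by rewrite mulmx1; apply/matrixP => i j; rewrite mul_diag_mx !mxE expr0 mul1r.
rewrite walk_mxS mulmxA IH -mulmxA star_mx_diag mulmxA; congr (_ *m _).
by apply/matrixP => i j; rewrite mul_diag_mx !mxE mulrnAr -exprSr.
Qed.

(** By translation invariance all n! diagonal entries of [walk_mx m] are equal. *)
Lemma star_walks_trace m : (n`! * star_walks l m 1%g)%:R = \sum_i d 0 i ^+ m.
Proof.
have <- : \tr (walk_mx m) = (n`! * star_walks l m 1%g)%:R.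
  rewrite /mxtrace (eq_bigr (fun=> (star_walks l m 1%g)%:R)) => [|x _]; last first.
    by rewrite mxE mulVg.
  by rewrite sumr_const card_ord card_Sn natrM mulr_natl.
have PE := spectral_walk_mx m.
rewrite -[walk_mx m](mulKmx (spectral_unit T)) -/P PE mxtrace_mulC mulmxK ?spectral_unit //.
by rewrite mxtrace_diag; apply: eq_bigr => i _; rewrite mxE.
Qed.

Lemma closed_star_walks_le m : (0 < m)%N ->
  (n`! * star_walks l m.*2 1%g <=
   n ^ m.*2 + \sum_(1 <= j < n) 2 * n ^ j.*2 * (n - j) ^ m.*2)%N.
Proof.
move=> m0; rewrite -(ler_nat algC) star_walks_trace natrD natrX natr_sum.
pose S (j : nat) := [set i : 'I_D | (n - j - 1)%:R < `|d 0 i|].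
pose b (j : nat) : algC := (n - j)%:R ^+ m.*2.
(* Each nonzero eigenvalue is charged to the least j with i in S j; since i is not in S (j - 1), its
   modulus is at most n - j. *)
have pointwise i : d 0 i ^+ m.*2 <= \sum_(0 <= j < n | i \in S j) b j.
  have [dr dn] := star_eigenvalue_le i.
  have -> : d 0 i ^+ m.*2 = `|d 0 i| ^+ m.*2.
    by rewrite -mul2n !exprM real_normK.
  have [->|d0] := eqVneq (d 0 i) 0.
    by rewrite normr0 expr0n double_eq0 gtn_eqF // sumr_ge0 // => j _; rewrite exprn_ge0.
  have S_last : i \in S n.-1.
    by rewrite inE (_ : n - n.-1 - 1 = 0)%N ?normr_gt0 //; lia.
  case: (ex_minnP (ex_intro (fun j => i \in S j) _ S_last)) => j ij jmin.
  have jn : (j < n)%N by have := jmin _ S_last; lia.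
  rewrite big_mkcond (bigD1_seq j) ?mem_index_iota ?iota_uniq //= ij.
  apply: ler_wpDr; first by apply: sumr_ge0 => k _; case: ifP => // _; rewrite exprn_ge0.
  rewrite lerXn2r ?nnegrE //; case: j ij jmin jn => [|j] _ jmin jn; first by rewrite subn0.
  have := contraNN (jmin j); rewrite ltnn => /(_ isT).
  rewrite inE -real_leNgt ?realn ?normr_real //.
  by rewrite -subnDA addn1.
apply: (@le_trans _ _ (\sum_(0 <= j < n) (#|S j|)%:R * b j)).
  apply: le_trans (ler_sum _ (fun i _ => pointwise i)) _.
  rewrite (exchange_big_dep xpredT) //= le_eqVlt; apply/orP; left; apply/eqP.
  by apply: eq_bigr => j _; rewrite sumr_const mulr_natl.
(* The class j = 0 has at most one element and gives the term n^(2m) with coefficient 1. *)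
rewrite [leLHS]big_ltn //; apply: lerD.
  rewrite /b subn0 ler_piMl ?exprn_ge0 // (ler_nat _ _ 1).
  by rewrite /S subn0 subn1 card_star_eigenvalues1.
rewrite !big_nat; apply: ler_sum => j jn; rewrite natrM natrX ler_wpM2r ?exprn_ge0 //.
by rewrite ler_nat card_star_eigenvalues.
Qed.

End StarTransposition.

Require Import Defs.
From mathcomp Require Import all_classical all_reals all_analysis.
From mathcomp Require Import lra ring.
Import Order.TTheory GRing.Theory Num.Theory.
Import numFieldNormedType.Exports.

(** * The walk conditioned on the selected positions *)

Section MeanOverWords.
Context (R : realFieldType) (I : finType).

Fixpoint mean_words (k : nat) (F : seq I -> R) : R :=
  if k is k'.+1 then #|I|%:R^-1 * \sum_i mean_words k' (fun w => F (i :: w)) else F [::].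

Lemma eq_mean_words k F G : F =1 G -> mean_words k F = mean_words k G.
Proof.
elim: k F G => [|k IH] F G FG /=; first exact: FG.
by congr (_ * _); apply: eq_bigr => i _; apply: IH => w; apply: FG.
Qed.

Lemma ler_mean_words k F G : (forall w, F w <= G w) -> mean_words k F <= mean_words k G.
Proof.
elim: k F G => [|k IH] F G FG /=; first exact: FG.
by rewrite ler_wpM2l ?invr_ge0 // ler_sum // => i _; apply: IH => w; apply: FG.
Qed.

Lemma mean_words_sum (T : finType) (A : {pred T}) k F :
  mean_words k (fun w => \sum_(t in A) F t w) = \sum_(t in A) mean_words k (F t).
Proof.
elim: k F => [|k IH] F //=; rewrite -mulr_sumr exchange_big /=.
by congr (_ * _); apply: eq_bigr => i _; rewrite -IH.
Qed.

Lemma mean_wordsZ k a F : mean_words k (fun w => a * F w) = a * mean_words k F.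
Proof.
elim: k F => [|k IH] F //=; rewrite mulrCA; congr (_ * _).
by rewrite mulr_sumr; apply: eq_bigr => i _; rewrite IH.
Qed.

Lemma mean_wordsD k F G :
  mean_words k (fun w => F w + G w) = mean_words k F + mean_words k G.
Proof.
elim: k F G => [|k IH] F G //=; rewrite -mulrDr -big_split /=; congr (_ * _).
by apply: eq_bigr => i _; rewrite -IH.
Qed.

Lemma mean_wordsB k F G :
  mean_words k (fun w => F w - G w) = mean_words k F - mean_words k G.
Proof.
under eq_mean_words => w do rewrite -mulN1r.
by rewrite mean_wordsD mean_wordsZ mulN1r.
Qed.

Lemma ler_norm_mean_words k F : `|mean_words k F| <= mean_words k (fun w => `|F w|).
Proof.
elim: k F => [|k IH] F //=; rewrite normrM ger0_norm ?invr_ge0 //.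
rewrite ler_wpM2l ?invr_ge0 //; apply: le_trans (ler_norm_sum _ _ _) _.
by apply: ler_sum => i _; apply: IH.
Qed.

Lemma mean_words0 k : mean_words k (fun=> 0) = 0.
Proof. by elim: k => [|k IH] //=; rewrite IH big1 ?mulr0. Qed.

Lemma mean_words_all k (p : {pred I}) :
  mean_words k (fun w => (all (mem p) w)%:R) = (#|p|%:R / #|I|%:R) ^+ k.
Proof.
elim: k => [|k IH] //=; rewrite exprS -IH mulrAC [RHS]mulrC; congr (_ * _).
rewrite (bigID (mem p)) /= [X in _ + X]big1 => [|i /negbTE ip]; last first.
  by rewrite (eq_mean_words _ (G := fun=> 0)) ?mean_words0 // => w; rewrite ip.
rewrite addr0 (eq_bigr (fun=> mean_words k (fun w => (all (mem p) w)%:R))).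
  by rewrite sumr_const mulr_natl.
by move=> i ip; apply: eq_mean_words => w; rewrite ip.
Qed.

Hypothesis I_gt0 : (0 < #|I|)%N.

Lemma mean_words_cst k c : mean_words k (fun=> c) = c.
Proof.
elim: k => [|k IH] //=; rewrite IH sumr_const -[c *+ _]mulr_natl mulrA mulVf ?mul1r //.
by rewrite pnatr_eq0 -lt0n.
Qed.

End MeanOverWords.

Section StarWalkLaw.
Context (n : nat) (l : 'I_n).

(** The last step comes first in w and multiplies on the right, as [wreath_mul] reverses the order
    of permutations. *)
Fixpoint word_perm (w : seq 'I_n) : 'S_n :=
  if w is i :: w' then (word_perm w' * tperm i l)%g else 1%g.

Lemma mean_word_perm (R : realFieldType) k s :
  mean_words k (fun w => (s == word_perm w)%:R) = (star_walks l k s)%:R / n%:R ^+ k :> R.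
Proof.
elim: k s => [|k IH] s /=; first by rewrite expr0 divr1.
rewrite card_ord natr_sum exprS invfM [RHS]mulrCA mulr_suml; congr (_ * _).
apply: eq_bigr => i _; rewrite -IH; apply: eq_mean_words => w.
by rewrite -(inj_eq (mulIg (tperm i l))) -mulgA tperm2 mulg1.
Qed.

(** The letters are involutions, so a walk to s reversed is a walk back from s; with a = b this
    makes the squared L^2 norm a return count. *)
Lemma star_walks_mul a b :
  (\sum_s star_walks l a s * star_walks l b s)%N = star_walks l (a + b) 1%g.
Proof.
elim: a b => [|a IH] b.
  rewrite (bigD1 1%g) //= eqxx mul1n big1 ?addn0 ?add0n // => s /negbTE-> //.
rewrite addSnnS -IH /=.
under eq_bigr => s _ do rewrite big_distrl.
under [RHS]eq_bigr => s _ do rewrite big_distrr.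
rewrite exchange_big [RHS]exchange_big; apply: eq_bigr => i _ /=.
rewrite (reindex_inj (mulIg (tperm i l))) /=; apply: eq_bigr => s _.
by rewrite -mulgA tperm2 mulg1.
Qed.

End StarWalkLaw.

Section WarpTransposeWalk.
Context (R : realType) (gT : finGroupType) (n : nat) (l : 'I_n).
Hypothesis l_last : l.+1 = n.
Local Notation W := (wreath gT n).
Local Notation P := (warp_transpose_top R gT n).

Let n_gt0 : (0 < n)%N. Proof. by rewrite -l_last. Qed.
Let gT_gt0 : (0 < #|gT|)%N. Proof. by apply/card_gt0P; exists 1%g. Qed.

Definition shuffle_step (i : 'I_n) (g : gT) : W :=
  if i == l then warp_elt l g else warp_transpose_elt l i g.

Lemma wreath_eqP (x y : W) :
  (forall i, wcoord x i = wcoord y i) -> wperm x = wperm y -> x = y.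
Proof. by case: x y => [c s] [c' s'] /= /ffunP-> ->. Qed.

Lemma wperm_shuffle_step i g : wperm (shuffle_step i g) = tperm i l.
Proof. by rewrite /shuffle_step; case: eqP => [->|] //=; rewrite tperm1. Qed.

Lemma shuffle_step_inj i j g h : shuffle_step i g = shuffle_step j h -> i = j /\ g = h.
Proof.
move=> e; have := congr1 (@wperm _ _) e; rewrite !wperm_shuffle_step => te.
have ij : i = j by have := congr1 (fun s : 'S_n => s l) te; rewrite !tpermR.
split=> //; have := congr1 (fun x : W => wcoord x l) e; rewrite -ij /shuffle_step.
by case: eqP => [_|/eqP il] /=; rewrite !ffunE ?eqxx // eq_sym (negbTE il).
Qed.

Lemma warp_transpose_supportE x :
  (x \in warp_transpose_support gT n) = [exists ig : 'I_n * gT, x == shuffle_step ig.1 ig.2].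
Proof.
rewrite inE; apply/existsP/existsP => [[l' /andP[/eqP l'n]]|[[i g] /= /eqP->]].
  have -> : l' = l by apply/val_inj/succn_inj; rewrite l'n.
  case/orP => [/existsP[g xg]|/existsP[i /andP[il /existsP[g xg]]]].
    by exists (l, g); rewrite /shuffle_step eqxx.
  exists (i, g); rewrite /shuffle_step /=.
  by have /negbTE-> : i != l by rewrite -val_eqE /= neq_ltn il.
exists l; rewrite l_last eqxx /= /shuffle_step; case: eqVneq => [_|il].
  by apply/orP; left; apply/existsP; exists g.
apply/orP; right; apply/existsP; exists i; rewrite ltn_neqAle il -ltnS l_last ltn_ord /=.
by apply/existsP; exists g.
Qed.

Lemma warp_transpose_topE x :
  P x = (n%:R * #|gT|%:R)^-1 * \sum_i \sum_g (x == shuffle_step i g)%:R.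
Proof.
rewrite pair_bigA /= /warp_transpose_top warp_transpose_supportE.
case: existsP => [[[i g] /= /eqP xig]|no].
  rewrite (bigD1 (i, g)) //= -xig eqxx big1 ?addr0 ?mulr1 // => -[j h] /= ne.
  case: eqP => // xjh; case/eqP: ne; rewrite xig in xjh.
  by have [-> ->] := shuffle_step_inj xjh.
rewrite big1 ?mulr0 // => -[i g] _ /=; case: eqP => // xig.
by case: no; exists (i, g); rewrite xig /=.
Qed.

Lemma warp_eltM j g h : (warp_elt j g * warp_elt j h)%g = warp_elt j (g * h)%g :> W.
Proof.
apply: wreath_eqP => [i|]; rewrite /= ?mulg1 // !ffunE invg1 perm1.
by case: eqP; rewrite ?mulg1.
Qed.

Lemma warp_elt1 j : warp_elt j 1%g = 1%g :> W.
Proof. by apply: wreath_eqP => [i|] //=; rewrite !ffunE; case: eqP. Qed.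

Lemma warp_eltC i j g h : i != j ->
  (warp_elt i g * warp_elt j h)%g = (warp_elt j h * warp_elt i g)%g :> W.
Proof.
move=> ij; apply: wreath_eqP => [k|]; rewrite /= ?mulg1 // !ffunE invg1 perm1.
have [->|ki] := eqVneq k i; last by rewrite mulg1 mul1g.
by rewrite (negbTE ij) mulg1 mul1g.
Qed.

Lemma shuffle_step_warp i j h : i != l ->
  (shuffle_step i 1 * warp_elt j h)%g = (warp_elt (tperm i l j) h * shuffle_step i 1)%g.
Proof.
move=> il; rewrite /shuffle_step (negbTE il).
apply: wreath_eqP => [k|]; rewrite /= ?mulg1 ?mul1g // !ffunE !invg1 tpermV perm1.
by rewrite (canF_eq (tpermK i l)) !if_same mulg1 mul1g.
Qed.

Lemma shuffle_stepE i g : i != l ->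
  shuffle_step i g = (warp_elt i g^-1 * (warp_elt l g * shuffle_step i 1))%g.
Proof.
move=> il; rewrite /shuffle_step (negbTE il).
apply: wreath_eqP => [k|]; rewrite /= ?mulg1 ?mul1g // !ffunE !invg1 !perm1 !if_same.
have [->|ki] := eqVneq k i; first by rewrite (negbTE il) !mulg1.
by rewrite mul1g mulg1.
Qed.

Lemma shuffle_stepV i g :
  ((shuffle_step i g)^-1 = shuffle_step i (if i == l then g^-1 else g))%g.
Proof.
apply: (mulgI (shuffle_step i g)); rewrite mulgV.
have [->|il] := eqVneq i l.
  by rewrite /shuffle_step eqxx warp_eltM mulgV warp_elt1.
rewrite /shuffle_step (negbTE il); apply: wreath_eqP => [k|] /=; last by rewrite tperm2.
rewrite !ffunE tpermV; case: tpermP => [->|->|/eqP ki /eqP kl].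
- by rewrite eqxx (eq_sym l) (negbTE il) eqxx mulVg.
- by rewrite (eq_sym l) (negbTE il) !eqxx mulgV.
by rewrite (negbTE ki) (negbTE kl) mulg1.
Qed.

(* One step of the walk with selected position i, applied to a law q; there is
   no inverse since the set of the steps (i, g), g in G, is closed under it. *)
Definition avg_step (i : 'I_n) (q : W -> R) : W -> R :=
  fun x => #|gT|%:R^-1 * \sum_g q (shuffle_step i g * x)%g.

(* The law of the walk given the selected positions, the last step coming first. *)
Fixpoint word_law (w : seq 'I_n) : W -> R :=
  if w is i :: w' then avg_step i (word_law w') else fun x => (x == 1%g)%:R.

Lemma conv_warp_transpose_top q x :
  Defs.conv P q x = #|'I_n|%:R^-1 * \sum_i avg_step i q x.
Proof.
rewrite /Defs.conv (reindex_inj (inj_comp (mulIg x) (@invg_inj _))) /=.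
under eq_bigr => z _.
  rewrite invMg invgK mulKVg warp_transpose_topE -mulrA mulr_suml.
  under eq_bigr => i _ do rewrite mulr_suml.
  over.
rewrite -mulr_sumr invfM -mulrA card_ord; congr (_ * _).
rewrite exchange_big mulr_sumr; apply: eq_bigr => i _ /=.
rewrite exchange_big; congr (_ * _).
have h_inj : injective (fun g : gT => if i == l then g^-1 else g)%g.
  by case: eqP => _ // a b /invg_inj.
rewrite [RHS](reindex_inj h_inj) /=; apply: eq_bigr => g _.
rewrite -shuffle_stepV (bigD1 (shuffle_step i g)) //= eqxx mul1r big1 ?addr0 //.
by move=> z /negbTE->; rewrite mul0r.
Qed.

Lemma conv_pow_mean k x : conv_pow P k x = mean_words k (fun w => word_law w x).
Proof.
elim: k x => [|k IH] x //=; rewrite -/(conv_pow P k) conv_warp_transpose_top.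
congr (_ * _); apply: eq_bigr => i _; rewrite mean_wordsZ mean_words_sum.
by congr (_ * _); apply: eq_bigr => g _.
Qed.

(** Left multiplication by [warp_elt j h] changes coordinate j only, so this says that coordinate j
    is uniform given all the rest. *)
Definition coord_invariant (q : W -> R) (j : 'I_n) :=
  forall h x, q (warp_elt j h * x)%g = q x.

(** The step exchanges the roles of i and l: invariance at i comes from that of q at l, and
    invariance at l from the average over h. *)
Lemma avg_coord_invariant (i : 'I_n) (B : seq 'I_n) (q : W -> R) : i != l ->
  (forall j, j \in l :: B -> coord_invariant q j) ->
  forall j, j \in l :: i :: B -> coord_invariant
    (fun x => #|gT|%:R^-1 * \sum_h q (warp_elt i h * (shuffle_step i 1 * x))%g) j.
Proof.
move=> il qB j jB z x; congr (_ * _).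
under eq_bigr => h _ do rewrite (mulgA _ (warp_elt j z)) shuffle_step_warp // -mulgA.
have [ji|ji] := eqVneq (tperm i l j) i.
  rewrite [RHS](reindex_inj (mulIg z)); apply: eq_bigr => h _.
  by rewrite ji (mulgA (warp_elt i h)) warp_eltM.
apply: eq_bigr => h _; rewrite (mulgA (warp_elt i h)) warp_eltC 1?eq_sym // -mulgA [LHS]qB //.
move: jB ji; rewrite !inE; case: tpermP => [->|->|/eqP/negbTE-> /eqP/negbTE->];
  by rewrite ?eqxx.
Qed.

Lemma avg_step_lE q x : avg_step l q x = #|gT|%:R^-1 * \sum_g q (warp_elt l g * x)%g.
Proof. by rewrite /avg_step /shuffle_step eqxx. Qed.

Lemma avg_cst (q : gT -> R) a : (forall g, q g = a) -> #|gT|%:R^-1 * \sum_g q g = a.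
Proof.
move=> qa; rewrite (eq_bigr (fun=> a)) // sumr_const -[a *+ _]mulr_natl mulrA mulVf ?mul1r //.
by rewrite pnatr_eq0 -lt0n.
Qed.

Lemma avg_step_l_invariant q : coord_invariant (avg_step l q) l.
Proof.
move=> h x; rewrite !avg_step_lE; congr (_ * _).
rewrite [RHS](reindex_inj (mulIg h)); apply: eq_bigr => g _.
by rewrite mulgA warp_eltM.
Qed.

(* Averaging the last coordinate absorbs the dependency between the two
   coordinates modified by a transposition step. *)
Lemma avg_step_l_avg_step i q x : i != l ->
  avg_step l (avg_step i q) x =
  #|gT|%:R^-1 * \sum_h avg_step l q (warp_elt i h * (shuffle_step i 1 * x))%g.
Proof.
move=> il; rewrite avg_step_lE; congr (_ * _).
rewrite /avg_step -!mulr_sumr; congr (_ * _).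
rewrite exchange_big [RHS]exchange_big /=; apply: eq_bigr => g _.
(* The substitution h -> g h cancels the factor g^-1 in coordinate i. *)
rewrite (reindex_inj (mulgI g)) /=; apply: eq_bigr => h _; congr q.
rewrite shuffle_stepE // -!mulgA [(shuffle_step i 1 * (_ * _))%g]mulgA.
rewrite shuffle_step_warp // tpermR [in RHS]/shuffle_step eqxx -mulgA.
have swap z y :
    (warp_elt l g * (warp_elt i z * y) = warp_elt i z * (warp_elt l g * y))%g.
  by rewrite (mulgA (warp_elt l g)) (@warp_eltC l i) 1?eq_sym // -mulgA.
by rewrite !swap (mulgA (warp_elt i _)) warp_eltM mulKg.
Qed.

(** The first claim is what survives while l may be unselected: one more average over coordinate l
    makes all selected coordinates uniform. Selecting l performs that average, which gives the
    second claim. *)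
Lemma word_law_invariant w :
  (forall j, j \in l :: w -> coord_invariant (avg_step l (word_law w)) j) /\
  (l \in w -> forall j, j \in w -> coord_invariant (word_law w) j).
Proof.
elim: w => [|i w [IH1 IH2]] /=.
  by split=> // j; rewrite inE => /eqP->; exact: avg_step_l_invariant.
have [->|il] := eqVneq i l.
  split=> [j jw h x|_ j jw]; last exact: IH1.
  rewrite 2!avg_step_lE; congr (_ * _); apply: eq_bigr => g _.
  have jw' : j \in l :: w by move: jw; rewrite !inE orbA orbb.
  rewrite [RHS]IH1 ?mem_head //.
  by rewrite IH1 ?mem_head // IH1.
split=> [j jw h x|].
  by rewrite !avg_step_l_avg_step //; apply: (avg_coord_invariant (B := w)).
rewrite inE (eq_sym l) (negbTE il) /= => lw j jw h x.
(* Coordinate l is already uniform and absorbs its factor g, which leaves the average over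
   coordinate i. *)
have qE y : avg_step i (word_law w) y =
    #|gT|%:R^-1 * \sum_h word_law w (warp_elt i h * (shuffle_step i 1 * y))%g.
  rewrite /avg_step; congr (_ * _); rewrite [RHS](reindex_inj (@invg_inj _)).
  apply: eq_bigr => g _; rewrite shuffle_stepE // -!mulgA.
  by rewrite (mulgA (warp_elt i _)) warp_eltC // -mulgA [LHS]IH2 // invgK.
rewrite !qE; apply: (avg_coord_invariant (B := w)) => //; last by rewrite inE jw orbT.
by move=> j'; rewrite inE => /predU1P[->|]; exact: IH2.
Qed.

Lemma word_law_wperm w x y : (forall i, i \in w) -> wperm x = wperm y ->
  word_law w x = word_law w y.
Proof.
move=> wT; case: x y => [c s] [d s'] /= <- {s'}.
have winv j : coord_invariant (word_law w) j by apply: (word_law_invariant w).2.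
(* The coordinates of d are replaced by those of c one at a time. *)
suff H (js : seq 'I_n) :
    word_law w (Wreath [ffun j => if j \in js then c j else d j] s) =
    word_law w (Wreath d s).
  rewrite -(H (enum 'I_n)); congr (word_law w (Wreath _ s)).
  by apply/ffunP => j; rewrite ffunE mem_enum.
elim: js => [|j js <-]; first by congr (word_law w (Wreath _ s)); apply/ffunP => j; rewrite ffunE.
rewrite -[RHS](winv j (c j * ([ffun j => if j \in js then c j else d j] j)^-1)%g).
congr word_law; apply: wreath_eqP => [k|]; rewrite /= ?mulg1 // !ffunE invg1 perm1 inE.
by case: (eqVneq k j) => [->|] /=; rewrite ?mulgKV ?mul1g // ffunE.
Qed.

Lemma sum_word_law_wperm w s : \sum_(x | wperm x == s) word_law w x = (s == word_perm l w)%:R.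
Proof.
elim: w s => [|i w IH] s /=.
  have [->|s1] := eqVneq s 1%g.
    by rewrite (bigD1 1%g) //= eqxx big1 ?addr0 // => x /andP[_ /negbTE->].
  rewrite big1 // => x /eqP xs; case: eqP => // x1.
  by rewrite -xs x1 eqxx in s1.
rewrite -mulr_sumr exchange_big; apply: avg_cst => g.
rewrite (reindex_inj (mulgI (shuffle_step i g)^-1%g)) /=.
have -> : (s == word_perm l w * tperm i l)%g = (s * tperm i l == word_perm l w)%g.
  by rewrite -(inj_eq (mulIg (tperm i l))) -mulgA tperm2 mulg1.
rewrite -IH; apply: eq_big => [x|x _]; last by rewrite mulKVg.
rewrite -[in RHS](inj_eq (mulIg (tperm i l))) -mulgA tperm2 mulg1.
by rewrite /= wperm_shuffle_step tpermV.
Qed.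

Lemma sum_wperm (f : 'S_n -> R) : \sum_(x : W) f (wperm x) = #|gT|%:R ^+ n * \sum_s f s.
Proof.
rewrite (reindex (@pair_wreath gT n)); last first.
  by exists (@wreath_pair gT n) => [[]|[]].
rewrite (eq_bigr (fun p : {ffun 'I_n -> gT} * 'S_n => f p.2)) //.
rewrite -(pair_bigA _ (fun _ s => f s)) /= sumr_const card_ffun card_ord -natrX.
by rewrite mulr_natl.
Qed.

Lemma card_wreath : #|{: W}| = (#|gT| ^ n * n`!)%N.
Proof.
have /bij_eq_card -> : bijective (@wreath_pair gT n).
  by exists (@pair_wreath gT n) => [[]|[]].
by rewrite card_prod card_ffun card_ord card_Sn.
Qed.

Lemma word_law_full w x : (forall i, i \in w) ->
  word_law w x = (#|gT|%:R ^+ n)^-1 * (wperm x == word_perm l w)%:R.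
Proof.
move=> wT; have G0 : (#|gT|%:R ^+ n : R) != 0 by rewrite expf_neq0 // pnatr_eq0 -lt0n.
apply: (mulfI G0); rewrite mulVKf // -sum_word_law_wperm.
rewrite (eq_bigr (fun=> word_law w x)) => [|y /eqP yx]; last exact: word_law_wperm.
rewrite sumr_const -[RHS]mulr_natl; congr (_ * _).
have := sum_wperm (fun s => (wperm x == s)%:R).
have -> : \sum_s (wperm x == s)%:R = 1 :> R.
  by rewrite (bigD1 (wperm x)) //= eqxx big1 ?addr0 // => s; rewrite eq_sym => /negbTE->.
rewrite mulr1 => <-; rewrite -sum1_card natr_sum [RHS]big_mkcond; apply: eq_bigr => y _.
by rewrite -[_ \in _]/(wperm y == wperm x) eq_sym; case: eqP.
Qed.

Lemma word_law_ge0 w x : 0 <= word_law w x.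
Proof.
elim: w x => [|i w IH] x //=; by rewrite mulr_ge0 ?invr_ge0 // sumr_ge0.
Qed.

Lemma sum_word_law w : \sum_x word_law w x = 1.
Proof.
rewrite (partition_big (@wperm gT n) xpredT) //=.
rewrite (eq_bigr _ (fun s _ => sum_word_law_wperm w s)).
rewrite (bigD1 (word_perm l w)) //= eqxx big1 ?addr0 // => s /negbTE-> //.
Qed.

Lemma sum_conv_pow k : \sum_x conv_pow P k x = 1.
Proof.
under eq_bigr => x _ do rewrite conv_pow_mean.
rewrite -mean_words_sum (eq_mean_words _ (G := fun=> 1)); last exact: sum_word_law.
by rewrite mean_words_cst ?card_ord.
Qed.

Lemma sum_uniform : \sum_x uniform R W x = 1.
Proof.
rewrite /uniform sumr_const -[LHS]mulr_natl mulfV // pnatr_eq0 -lt0n.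
by apply/card_gt0P; exists 1%g.
Qed.

Lemma sum_conv_pow_wperm k s :
  \sum_(x | wperm x == s) conv_pow P k x = (star_walks l k s)%:R / n%:R ^+ k.
Proof.
under eq_bigr => x _ do rewrite conv_pow_mean.
rewrite -mean_words_sum -mean_word_perm; apply: eq_mean_words => w.
exact: sum_word_law_wperm.
Qed.

(** The left side vanishes when all positions are selected and is at most 2 otherwise; the sum on
    the right is a union bound over missed positions. *)
Lemma word_law_dist w :
  \sum_x `|word_law w x - (#|gT|%:R ^+ n)^-1 * (wperm x == word_perm l w)%:R| <=
  2 * \sum_i (all (mem (predC1 i)) w)%:R.
Proof.
have [/forallP wT|] := boolP [forall i, i \in w].
  rewrite big1 => [|x _]; last by rewrite -word_law_full // subrr normr0.
  by rewrite mulr_ge0 // sumr_ge0.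
rewrite negb_forall => /existsP[i iw].
apply: (@le_trans _ _ 2).
  apply: (@le_trans _ _ (\sum_x (word_law w x +
      (#|gT|%:R ^+ n)^-1 * (wperm x == word_perm l w)%:R))).
    apply: ler_sum => x _; apply: le_trans (ler_normB _ _) _.
    by rewrite !ger0_norm ?word_law_ge0 // mulr_ge0 ?invr_ge0 ?exprn_ge0.
  rewrite big_split /= sum_word_law -mulr_sumr.
  rewrite (sum_wperm (fun s => (s == word_perm l w)%:R)) mulKf; last first.
    by rewrite expf_neq0 // pnatr_eq0 -lt0n.
  by rewrite (bigD1 (word_perm l w)) //= eqxx big1 ?addr0 // => s /negbTE->.
rewrite ler_peMr // (bigD1 i) //=.
have -> : all (mem (predC1 i)) w.
  by apply/allP => j jw; rewrite inE; apply: contraNneq iw => <-.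
by rewrite lerDl sumr_ge0.
Qed.

Lemma conv_pow_dist k :
  \sum_x `|conv_pow P k x - uniform R W x| <=
  2 * n%:R * (1 - n%:R^-1) ^+ k +
  \sum_s `|(star_walks l k s)%:R / n%:R ^+ k - (n`!)%:R^-1|.
Proof.
have G0 : (#|gT|%:R ^+ n : R) != 0 by rewrite expf_neq0 // pnatr_eq0 -lt0n.
pose q s : R := (star_walks l k s)%:R / n%:R ^+ k.
(* The intermediate law has the permutation of the walk and independent uniform coordinates. *)
apply: (@le_trans _ _ (\sum_x (`|conv_pow P k x - (#|gT|%:R ^+ n)^-1 * q (wperm x)| +
    `|(#|gT|%:R ^+ n)^-1 * (q (wperm x) - (n`!)%:R^-1)|))).
  apply: ler_sum => x _; apply: le_trans (ler_normD _ _); rewrite mulrBr addrA subrK.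
  by rewrite /uniform card_wreath natrM natrX invfM.
rewrite big_split /=; apply: lerD; last first.
  rewrite (eq_bigr (fun x => (#|gT|%:R ^+ n)^-1 * `|q (wperm x) - (n`!)%:R^-1|)); last first.
    by move=> x _; rewrite normrM ger0_norm ?invr_ge0 ?exprn_ge0.
  by rewrite -mulr_sumr (sum_wperm (fun s => `|q s - (n`!)%:R^-1|)) mulKf.
apply: (@le_trans _ _ (mean_words k (fun w => \sum_x
   `|word_law w x - (#|gT|%:R ^+ n)^-1 * (wperm x == word_perm l w)%:R|))).
  rewrite mean_words_sum; apply: ler_sum => x _.
  rewrite conv_pow_mean /q -mean_word_perm -mean_wordsZ -mean_wordsB.
  exact: ler_norm_mean_words.
apply: le_trans (ler_mean_words _ word_law_dist) _.
rewrite mean_wordsZ mean_words_sum -mulrA ler_wpM2l //.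
rewrite (eq_bigr (fun=> (1 - n%:R^-1) ^+ k)) => [|i _].
  by rewrite sumr_const card_ord mulr_natl.
rewrite mean_words_all cardC1 card_ord -subn1 natrB // mulrBl divff ?mul1r //.
by rewrite pnatr_eq0 -lt0n.
Qed.

End WarpTransposeWalk.

(** * From closed walk counts to an L^1 bound on the symmetric group *)

Lemma sqr_sum_le (R : realFieldType) (T : finType) (a : T -> R) :
  (\sum_t a t) ^+ 2 <= #|T|%:R * \sum_t a t ^+ 2.
Proof.
have [T0|T0] := posnP #|T|.
  rewrite big1 ?expr0n ?mulr_ge0 ?sumr_ge0 // => [t _|t _]; first by rewrite sqr_ge0.
  by have := fintype0 t T0.
have N0 : 0 < #|T|%:R :> R by rewrite ltr0n.
(* Cauchy-Schwarz follows from nonnegativity of the variance around the mean m. *)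
pose m := (\sum_t a t) / #|T|%:R.
have : 0 <= \sum_t (a t - m) ^+ 2 by apply: sumr_ge0 => t _; rewrite sqr_ge0.
under eq_bigr => t _ do rewrite sqrrB.
rewrite big_split sumrB /= sumr_const sumrMnl -mulr_suml.
set S := \sum_t a t; set Q := \sum_t a t ^+ 2.
have -> : Q - S * m *+ 2 + m ^+ 2 *+ #|T| = Q - S ^+ 2 / #|T|%:R.
  by rewrite -[m ^+ 2 *+ _]mulr_natr /m -/S; field; exact: lt0r_neq0.
by rewrite subr_ge0 ler_pdivrMr // mulrC.
Qed.

Section StarWalkL2.
Context (R : realType) (n : nat) (l : 'I_n).
Hypothesis l_last : l.+1 = n.

Let n_gt0 : (0 < n)%N. Proof. by rewrite -l_last. Qed.

Lemma sum_star_walks k : \sum_s (star_walks l k s)%:R / n%:R ^+ k = 1 :> R.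
Proof.
under eq_bigr => s _ do rewrite -mean_word_perm.
rewrite -mean_words_sum (eq_mean_words _ (G := fun=> 1)) ?mean_words_cst ?card_ord // => w.
by rewrite (bigD1 (word_perm l w)) //= eqxx big1 ?addr0 // => s /negbTE->.
Qed.

(** After Cauchy-Schwarz, the squares sum to a return probability at time 2k, and the leading term
    n^(2k) of the closed walk count cancels the - 1. *)
Lemma star_walks_l2 k : (0 < k)%N ->
  (\sum_s `|(star_walks l k s)%:R / n%:R ^+ k - (n`!)%:R^-1|) ^+ 2 <=
  \sum_(1 <= j < n) 2 * (n%:R ^+ j.*2 * ((n - j)%:R / n%:R) ^+ k.*2) :> R.
Proof.
move=> k0; have nk0 : (n%:R ^+ k : R) != 0 by rewrite expf_neq0 // pnatr_eq0 -lt0n.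
have N0 : (n`!)%:R != 0 :> R by rewrite pnatr_eq0 -lt0n fact_gt0.
apply: le_trans (sqr_sum_le _) _; rewrite card_Sn.
under eq_bigr => s _ do rewrite real_normK ?num_real // sqrrB.
have qN : \sum_s (star_walks l k s)%:R / n%:R ^+ k * (n`!)%:R^-1 = (n`!)%:R^-1 :> R.
  by rewrite -mulr_suml sum_star_walks mul1r.
rewrite big_split sumrB /= sumr_const sumrMnl qN.
rewrite (_ : #|_| = n`!) ?card_Sn //.
have -> : \sum_s ((star_walks l k s)%:R / n%:R ^+ k) ^+ 2 =
    (star_walks l k.*2 1%g)%:R / n%:R ^+ k.*2 :> R.
  rewrite -addnn -star_walks_mul natr_sum mulr_suml; apply: eq_bigr => s _.
  by rewrite natrM exprD invfM expr2 mulrACA.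
have -> (Q : R) : (n`!)%:R * (Q - (n`!)%:R^-1 *+ 2 + (n`!)%:R^-1 ^+ 2 *+ n`!) = (n`!)%:R * Q - 1.
  by rewrite -[_ ^+ 2 *+ _]mulr_natr; field.
rewrite lerBlDl mulrA -natrM.
have nk20 : 0 < n%:R ^+ k.*2 :> R by rewrite exprn_gt0 // ltr0n.
rewrite ler_pdivrMr //.
have := closed_star_walks_le l_last k0; rewrite -(ler_nat R) => /le_trans; apply.
rewrite natrD natrX mulrDl mul1r lerD2l natr_sum mulr_suml.
rewrite le_eqVlt; apply/orP; left; apply/eqP; apply: eq_bigr => j _.
by rewrite !natrM !natrX expr_div_n -!mulrA mulVf ?mulr1 // lt0r_neq0.
Qed.

Lemma sum_expr_le2 (r : R) m : 0 <= r -> r <= 2^-1 -> \sum_(0 <= j < m) r ^+ j <= 2.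
Proof.
move=> r0 r2; elim: m => [|m IH]; first by rewrite big_geq.
rewrite big_nat_recl // expr0; under eq_bigr => j _ do rewrite exprS.
by rewrite -mulr_sumr; nra.
Qed.

Lemma star_walks_l1 k : (0 < k)%N ->
  let a : R := n%:R * expR (- (k%:R / n%:R)) in a <= 2^-1 ->
  \sum_s `|(star_walks l k s)%:R / n%:R ^+ k - (n`!)%:R^-1| <= 2 * a.
Proof.
move=> k0 a a2; have nR0 : 0 < n%:R :> R by rewrite ltr0n.
have a0 : 0 < a by rewrite mulr_gt0 // expR_gt0.
rewrite -(@ler_pXn2r _ 2) ?nnegrE ?mulr_ge0 ?sumr_ge0 // ?(ltW a0) //.
apply: le_trans (star_walks_l2 k0) _.
(* The bound 1 - j / n <= exp(- j / n) turns the j-th term into a^(2j); the geometric series is then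
   at most 4 a^2. *)
apply: (@le_trans _ _ (\sum_(1 <= j < n) 2 * (a ^+ 2) ^+ j)).
  rewrite !big_nat; apply: ler_sum => j /andP[j1 jn].
  rewrite ler_wpM2l // -exprM mul2n /a [in leRHS]exprMn ler_wpM2l ?exprn_ge0 ?ler0n //.
  have -> : expR (- (k%:R / n%:R)) ^+ j.*2 = expR (- (j%:R / n%:R)) ^+ k.*2 :> R.
    by rewrite -!expRM_natl -!mul2n !natrM; congr expR; field; exact: lt0r_neq0.
  rewrite lerXn2r ?nnegrE ?divr_ge0 ?expR_ge0 //.
  rewrite natrB ?(ltnW jn) // mulrBl divff ?lt0r_neq0 //.
  exact: expR_ge1Dx.
rewrite -mulr_sumr; case: (n) n_gt0 => // m _; rewrite big_add1 /=.
under eq_bigr => j _ do rewrite exprS.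
rewrite -mulr_sumr.
have := @sum_expr_le2 (a ^+ 2) m; set S := \sum_(0 <= _ < _) _ => /(_ _ _)/wrap[].
- by rewrite sqr_ge0.
- by nra.
by move=> S2; have := sqr_ge0 a; nra.
Qed.

End StarWalkL2.

(** * Total variation bounds *)

Section TotalVariationBounds.
Context (R : realType) (gT : finGroupType) (n : nat) (l : 'I_n).
Hypothesis l_last : l.+1 = n.
Local Notation W := (wreath gT n).
Local Notation P := (warp_transpose_top R gT n).

Let n_gt0 : (0 < n)%N. Proof. by rewrite -l_last. Qed.
Let gT_gt0 : (0 < #|gT|)%N. Proof. by apply/card_gt0P; exists 1%g. Qed.

Lemma tv_distE k : tv_dist (conv_pow P k) (uniform R W) =
  2^-1 * \sum_x `|conv_pow P k x - uniform R W x|.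
Proof. by rewrite tv_dist_sum // (sum_conv_pow _ _ l_last) sum_uniform. Qed.

Lemma tv_dist_le k : (0 < k)%N ->
  let a : R := n%:R * expR (- (k%:R / n%:R)) in a <= 2^-1 ->
  tv_dist (conv_pow P k) (uniform R W) <= 2 * a.
Proof.
move=> k0 a a2; rewrite tv_distE ler_pdivrMl //.
apply: le_trans (conv_pow_dist _ _ l_last k) _.
have -> : 2 * (2 * a) = 2 * a + 2 * a by ring.
apply: lerD; last exact: star_walks_l1.
rewrite -mulrA ler_wpM2l // ler_wpM2l //.
have -> : - (k%:R / n%:R) = k%:R * - n%:R^-1 :> R by rewrite mulrN.
rewrite expRM_natl lerXn2r ?nnegrE ?expR_ge0 ?expR_ge1Dx //.
by rewrite subr_ge0 invf_le1 ?ltr0n // ler1n.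
Qed.

Lemma tv_dist_le1 k : tv_dist (conv_pow P k) (uniform R W) <= 1.
Proof.
rewrite tv_distE ler_pdivrMl // mulr1.
apply: (@le_trans _ _ (\sum_x (conv_pow P k x + uniform R W x))).
  apply: ler_sum => x _; apply: le_trans (ler_normB _ _) _; rewrite !ger0_norm //.
    by rewrite /uniform invr_ge0.
  rewrite (conv_pow_mean R l_last) -[leLHS](@mean_words0 R 'I_n k).
  by apply: ler_mean_words => w; apply: word_law_ge0.
by rewrite big_split /= (sum_conv_pow _ _ l_last) sum_uniform.
Qed.

Definition fixpoints (s : 'S_n) := #|[pred i | s i == i]|.

(** The number of s with s i = i equals the number with s l = j for any j, and the events s l = j
    partition the permutations. *)
Lemma sum_fixpoints : (\sum_s fixpoints s = n`!)%N.
Proof.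
have count i j : (\sum_(s : 'S_n) (s i == j) = \sum_(s : 'S_n) (s i == i))%N.
  rewrite (reindex_inj (mulIg (tperm i j))) /=; apply: eq_bigr => s _.
  by rewrite permM -[in RHS](inj_eq (@perm_inj _ (tperm i j))) tpermL.
have -> : (\sum_s fixpoints s = \sum_i \sum_(s : 'S_n) (s i == i))%N.
  rewrite exchange_big /=; apply: eq_bigr => s _.
  by rewrite /fixpoints -sum1_card big_mkcond; apply: eq_bigr => i _; rewrite inE; case: eqP.
transitivity (\sum_j \sum_(s : 'S_n) (s l == j))%N.
  have cj i : (\sum_(s : 'S_n) (s i == i) = \sum_(s : 'S_n) (s l == l))%N.
    rewrite -(count i l) (reindex_inj (mulgI (tperm i l))) /=.
    by apply: eq_bigr => s _; rewrite permM tpermL.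
  by apply: eq_bigr => i _; rewrite cj count.
rewrite exchange_big /= -card_Sn -sum1_card; apply: eq_bigr => s _.
by rewrite (bigD1 (s l)) //= eqxx big1 // => j; rewrite eq_sym => /negbTE->.
Qed.

Lemma word_perm_id (w : seq 'I_n) i : i != l -> i \notin w -> word_perm l w i = i.
Proof.
move=> il; elim: w => [|j w IH] /=; first by rewrite perm1.
rewrite inE negb_or => /andP[ij iw]; rewrite permM IH // tpermD // eq_sym //.
Qed.

(** The position l is left out because every transposition step moves it. *)
Definition untouched (w : seq 'I_n) : R := \sum_(i in predC1 l) (all (mem (predC1 i)) w)%:R.

Lemma untouched_le_fixpoints w : untouched w <= (fixpoints (word_perm l w))%:R.
Proof.
rewrite /untouched /fixpoints -sum1_card natr_sum big_mkcond [leRHS]big_mkcond /=.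
apply: ler_sum => i _; rewrite !inE; case: ifP => [il|_]; last by case: ifP.
case: allP => [iw|_]; last by case: ifP.
rewrite word_perm_id ?eqxx //; apply/negP => /iw; by rewrite /= !inE eqxx.
Qed.

Section SecondMoment.
Context (k : nat).
Let mu : R := (n.-1)%:R * (1 - n%:R^-1) ^+ k.

Lemma mean_untouched : mean_words k untouched = mu.
Proof.
rewrite mean_words_sum (eq_bigr (fun=> (1 - n%:R^-1) ^+ k)) => [|i _].
  by rewrite sumr_const cardC1 card_ord /mu mulr_natl.
rewrite mean_words_all cardC1 card_ord -subn1 natrB // mulrBl divff ?mul1r //.
by rewrite pnatr_eq0 -lt0n.
Qed.

(** The diagonal contributes mu; off the diagonal, 1 - 2 / n <= (1 - 1 / n)^2 shows negative
    correlation. *)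
Lemma mean_untouched_sqr : mean_words k (fun w => untouched w ^+ 2) <= mu + mu ^+ 2.
Proof.
have E (w : seq 'I_n) : untouched w ^+ 2 = \sum_(i in predC1 l) (\sum_(j in predC1 l)
    (all (mem (predC1 i)) w)%:R * (all (mem (predC1 j)) w)%:R).
  by rewrite expr2 {1}/untouched mulr_suml; apply: eq_bigr => i _; rewrite mulr_sumr.
rewrite (eq_mean_words _ E) mean_words_sum.
have n1 : 0 <= 1 - n%:R^-1 :> R by rewrite subr_ge0 invf_le1 ?ltr0n // ler1n.
have -> : mu + mu ^+ 2 = \sum_(i in predC1 l) ((1 - n%:R^-1) ^+ k + mu * (1 - n%:R^-1) ^+ k).
  by rewrite sumr_const cardC1 card_ord -[RHS]mulr_natl /mu; ring.
apply: ler_sum => i il; rewrite mean_words_sum (bigD1 i) //=; apply: lerD.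
  rewrite (eq_mean_words _ (G := fun w => (all (mem (predC1 i)) w)%:R)); last first.
    by move=> w; rewrite -natrM mulnb andbb.
  rewrite mean_words_all cardC1 card_ord -subn1 natrB // mulrBl divff ?mul1r //.
  by rewrite pnatr_eq0 -lt0n.
apply: (@le_trans _ _ (\sum_(j in predC1 l) ((1 - n%:R^-1) ^+ k * (1 - n%:R^-1) ^+ k))).
  rewrite big_mkcond [leRHS]big_mkcond; apply: ler_sum => j _.
  case: ifP => [/andP[jl ji]|_]; last by case: ifP => // _; rewrite mulr_ge0 ?exprn_ge0.
  rewrite jl (eq_mean_words _ (G := fun w => (all (mem [predC pred2 i j]) w)%:R)); last first.
    move=> w; rewrite -natrM mulnb -all_predI; congr (nat_of_bool _)%:R.
    by apply: eq_all => t; rewrite /= !inE negb_or.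
  rewrite mean_words_all -exprMn lerXn2r ?nnegrE ?divr_ge0 ?mulr_ge0 //.
  have n0 : 0 < n%:R :> R by rewrite ltr0n.
  have := cardC (pred2 i j); rewrite card2 eq_sym ji card_ord /= => cE.
  have -> : #|[predC pred2 i j]|%:R = n%:R - 2 :> R.
    have := congr1 (fun m => m%:R : R) cE; rewrite /= natrD => <-.
    by rewrite addrAC subrr add0r.
  rewrite -subr_ge0 (_ : _ - _ = n%:R^-1 ^+ 2) ?sqr_ge0 //.
  by field; exact: lt0r_neq0.
by rewrite sumr_const cardC1 card_ord -[leLHS]mulr_natl mulrA.
Qed.

Lemma tv_dist_ge : 0 < mu -> 1 - 6 / mu <= tv_dist (conv_pow P k) (uniform R W).
Proof.
(* The event is having at least mu / 2 fixed points: Chebyshev loses 4 / mu for the walk, Markov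
   gives 2 / mu for the uniform law. *)
move=> mu0; pose B := [pred s : 'S_n | mu / 2 <= (fixpoints s)%:R].
pose A : {set W} := [set x : W | B (wperm x)].
apply: (@le_trans _ _ (\sum_(x in A) conv_pow P k x - \sum_(x in A) uniform R W x)); last first.
  by apply: le_trans (ler_norm _) _; rewrite /tv_dist; apply: (le_bigmax _ _ A).
have PA : 1 - 4 / mu <= \sum_(x in A) conv_pow P k x.
  rewrite (partition_big (@wperm gT n) (mem B)) /=; last by move=> x; rewrite inE.
  rewrite (eq_bigr (fun s => mean_words k (fun w => (s == word_perm l w)%:R))); last first.
    move=> s Bs; rewrite mean_word_perm -(sum_conv_pow_wperm R gT l_last).
    by apply: eq_bigl => x; rewrite inE; case: eqP => [->|]; rewrite ?andbF // andbT.
  rewrite -mean_words_sum.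
  apply: (@le_trans _ _ (mean_words k (fun w => 1 - 4 / mu ^+ 2 * (untouched w - mu) ^+ 2))).
    rewrite mean_wordsB mean_words_cst ?card_ord // mean_wordsZ lerD2l lerN2.
    rewrite (eq_mean_words _ (G := fun w =>
      untouched w ^+ 2 - (mu *+ 2 * untouched w - mu ^+ 2))); last by move=> w; ring.
    rewrite !mean_wordsB mean_wordsZ mean_words_cst ?card_ord // mean_untouched.
    have := mean_untouched_sqr; set Q := mean_words _ _ => Qmu.
    have -> : 4 / mu = 4 / mu ^+ 2 * mu by field; exact: lt0r_neq0.
    by rewrite ler_wpM2l ?divr_ge0 ?exprn_ge0 ?(ltW mu0) //; nra.
  apply: ler_mean_words => w; have [Bw|Bw] := boolP (B (word_perm l w)).
    rewrite (bigD1 (word_perm l w)) //= eqxx; apply: ler_wpDr.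
      by apply: sumr_ge0.
    by rewrite gerBl mulr_ge0 ?divr_ge0 ?sqr_ge0.
  apply: (@le_trans _ _ 0); last exact: sumr_ge0.
  have uB : untouched w < mu / 2.
    by apply: le_lt_trans (untouched_le_fixpoints w) _; rewrite ltNge.
  rewrite subr_le0 mulrAC ler_pdivlMr ?exprn_gt0 // mul1r.
  by nra.
have UA : \sum_(x in A) uniform R W x <= 2 / mu.
  rewrite big_mkcond (eq_bigr (fun x : W => (B (wperm x))%:R / #|{: W}|%:R)); last first.
    by move=> x _; rewrite inE /uniform; case: (B _); rewrite ?mul1r ?mul0r.
  rewrite (sum_wperm gT (fun s => (B s)%:R / #|{: W}|%:R)) -mulr_suml card_wreath.
  have G0 : (#|gT|%:R ^+ n : R) != 0 by rewrite expf_neq0 // pnatr_eq0 -lt0n.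
  have N0 : 0 < (n`!)%:R :> R by rewrite ltr0n fact_gt0.
  rewrite natrM natrX invfM mulrCA mulVKf // ler_pdivrMr // mulrAC ler_pdivlMr //.
  have : \sum_s (B s)%:R * (mu / 2) <= (n`!)%:R :> R.
    rewrite -sum_fixpoints natr_sum; apply: ler_sum => s _.
    by case: (boolP (B s)) => h; rewrite ?mul1r ?mul0r.
  by rewrite -mulr_suml; lra.
have -> : 6 / mu = 4 / mu + 2 / mu by field; exact: lt0r_neq0.
by rewrite opprD addrA lerB.
Qed.

End SecondMoment.
End TotalVariationBounds.

(** * Coupon collector estimates on both sides of n log n *)

Section Asymptotics.
Context (R : realType).

Lemma expR_ln_cvg0 (eps : R) : 0 < eps ->
  (expR (- (eps * ln n%:R)) @[n --> \oo] --> 0)%classic.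
Proof.
move=> e0; apply/cvgrPdist_lt => d d0; near=> n.
have n0 : 0 < n%:R :> R by near: n; exact: nbhs_infty_gtr.
rewrite sub0r normrN ger0_norm ?expR_ge0 // -ltr_ln ?posrE ?expR_gt0 // expRK.
rewrite ltrNl mulrC -ltr_pdivrMr //.
rewrite -ltr_expR lnK ?posrE //.
near: n; exact: nbhs_infty_gtr.
Unshelve. all: by end_near. Qed.

Context (eps : R) (n : nat).
Hypothesis n_gt1 : (1 < n)%N.
Let nR : 1 < n%:R :> R. Proof. by rewrite ltr1n. Qed.
Let lnR : 0 <= ln n%:R :> R. Proof. by rewrite ln_ge0 // ltW. Qed.
Let expR_ln_n : expR (ln n%:R) = n%:R :> R. Proof. by rewrite lnK // posrE (lt_trans ltr01). Qed.

(** Truncation loses less than one step, which the factor [expR 1] absorbs. *)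
Lemma supercritical_coupon (k := Num.truncn ((1 + eps) * n%:R * ln n%:R)) : 0 < eps ->
  n%:R * expR (- (k%:R / n%:R)) <= expR 1 * expR (- (eps * ln n%:R)).
Proof.
move=> e0; have n1 := nR; have l0 := lnR.
have t0 : 0 <= (1 + eps) * n%:R * ln n%:R by rewrite !mulr_ge0 //; lra.
have /andP[_ kt] := truncn_itv t0.
rewrite -{1}expR_ln_n -!expRD ler_expR.
rewrite -lerBrDl.
have n0 : 0 < n%:R :> R by lra.
rewrite lerNl ler_pdivlMr //; rewrite -/k -natr1 in kt; nra.
Qed.

(** Uses 1 - 1 / n >= exp(- 1 / (n - 1)). Replacing n by n - 1 in the exponent costs at most 1,
    since ln n <= n - 1, whence [expR 1]; the 2 comes from (n - 1) / n >= 1 / 2. *)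
Lemma subcritical_coupon (k := Num.truncn ((1 - eps) * n%:R * ln n%:R)) :
  0 < eps -> eps < 1 ->
  (2 * expR 1 * expR (- (eps * ln n%:R)))^-1 <= (n.-1)%:R * (1 - n%:R^-1) ^+ k.
Proof.
move=> e0 e1; have n1 := nR; have l0 := lnR.
have t0 : 0 <= (1 - eps) * n%:R * ln n%:R by rewrite !mulr_ge0 //; lra.
have /andP[kt _] := truncn_itv t0; rewrite -/k in kt.
have -> : (n.-1)%:R = n%:R - 1 :> R by rewrite -subn1 natrB // ltnW.
have m0 : 0 < n%:R - 1 :> R by lra.
have n0 : 0 < n%:R :> R by lra.
have base : expR (- (n%:R - 1)^-1) <= 1 - n%:R^-1 :> R.
  rewrite expRN -[leRHS]invrK lef_pV2 ?posrE ?expR_gt0 ?invr_gt0 ?subr_gt0 ?invf_lt1 //.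
  have -> : (1 - n%:R^-1)^-1 = 1 + (n%:R - 1)^-1 :> R.
    by field; rewrite !lt0r_neq0.
  exact: expR_ge1Dx.
have lnn : ln n%:R <= n%:R - 1 :> R.
  by have := expR_ge1Dx (ln n%:R : R); rewrite expR_ln_n; lra.
apply: (@le_trans _ _ ((n%:R - 1) * expR (- (k%:R / (n%:R - 1))))); last first.
  rewrite ler_wpM2l ?(ltW m0) // -mulrN expRM_natl lerXn2r ?nnegrE ?expR_ge0 //.
  by rewrite subr_ge0 invf_le1 // ltW.
have kn : k%:R / (n%:R - 1) <= 1 + (1 - eps) * ln n%:R.
  rewrite ler_pdivrMr //; apply: le_trans kt _; nra.
apply: (@le_trans _ _ ((n%:R - 1) * expR (- (1 + (1 - eps) * ln n%:R)))); last first.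
  by rewrite ler_wpM2l ?(ltW m0) // ler_expR lerN2.
have -> : - (1 + (1 - eps) * ln n%:R) = - ln n%:R + (eps * ln n%:R - 1) by ring.
have -> : expR (- ln n%:R + (eps * ln n%:R - 1)) =
    n%:R^-1 * (expR (eps * ln n%:R) * (expR 1)^-1) :> R.
  by rewrite !expRD !expRN expR_ln_n.
rewrite expRN; set e := expR (eps * _).
have -> : (2 * expR 1 * e^-1)^-1 = 2^-1 * (e * (expR 1)^-1) :> R.
  by rewrite !invfM invrK -mulrA [(expR 1)^-1 * e]mulrC.
have n2 : 2 <= n%:R :> R by rewrite ler_nat.
rewrite [leRHS]mulrA ler_wpM2r ?mulr_ge0 ?invr_ge0 ?expR_ge0 // ler_pdivlMr //; lra.
Qed.

End Asymptotics.

(** * The cutoff, by squeezing on both sides *)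

Local Open Scope classical_set_scope.
Local Open Scope ring_scope.
Unset Implicit Arguments.
Set Strict Implicit.

Theorem theorem1p3 (R : realType) (G : nat -> finGroupType)
    (G_nontrivial : forall n : nat, (1 <= n)%N -> (1 < #|G n|)%N)
    (eps : R) (eps_gt0 : 0 < eps) (eps_lt1 : eps < 1) :
  (let k n := Num.truncn ((1 + eps) * n%:R * ln n%:R) in
   tv_dist (conv_pow (warp_transpose_top R (G n) n) (k n))
           (uniform R (wreath (G n) n)) @[n --> \oo] --> (0 : R))
  /\
  (let k n := Num.truncn ((1 - eps) * n%:R * ln n%:R) in
   tv_dist (conv_pow (warp_transpose_top R (G n) n) (k n))
           (uniform R (wreath (G n) n)) @[n --> \oo] --> (1 : R)).
Proof.
have tv_ge0 n k : 0 <= tv_dist (conv_pow (warp_transpose_top R (G n) n) k)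
    (uniform R (wreath (G n) n)) by exact: bigmax_ge_id.
have last_ord n : (1 < n)%N -> exists l : 'I_n, l.+1 = n.
  by case: n => // n _; exists ord_max.
split=> k.
  have lim0 : 2 * (expR 1 * expR (- (eps * ln n%:R))) @[n --> \oo] --> (0 : R).
    rewrite -[X in _ --> X](mulr0 (2 : R)); apply: cvgMr.
    rewrite -[X in _ --> X](mulr0 (expR 1 : R)); apply: cvgMr.
    exact: expR_ln_cvg0.
  apply: (squeeze_cvgr _ (cvg_cst 0) lim0); near=> n; rewrite tv_ge0 /=.
  have n1 : (1 < n)%N by near: n; exact: nbhs_infty_gt.
  have [l l_last] := last_ord n n1.
  have small : 2 * (expR 1 * expR (- (eps * ln n%:R))) <= 1 :> R.
    near: n; exact: (cvgr_le _ lim0).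
  have a_le := @supercritical_coupon R eps n n1 eps_gt0.
  have a_half : n%:R * expR (- ((k n)%:R / n%:R)) <= 2^-1 :> R.
    by apply: le_trans a_le _; rewrite -[leRHS]mulr1 ler_pdivlMl.
  (* At k n = 0 the bound [a_half] would read n <= 1 / 2. *)
  have k_gt0 : (0 < k n)%N.
    rewrite lt0n; apply: contraTneq a_half => ->.
    rewrite mul0r oppr0 expR0 mulr1 -ltNge (@lt_trans _ _ 1) ?ltr1n //.
    by rewrite invf_lt1 ?ltr1n.
  by apply: le_trans (tv_dist_le _ l_last k_gt0 a_half) _; rewrite ler_wpM2l.
(* The constant 12 combines the 6 of [tv_dist_ge] with the 2 of [subcritical_coupon]. *)
have lim1 : 1 - 12 * (expR 1 * expR (- (eps * ln n%:R))) @[n --> \oo] --> (1 : R).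
  rewrite -[X in _ --> X]subr0; apply: cvgB; first exact: cvg_cst.
  rewrite -[X in _ --> X](mulr0 (12 : R)); apply: cvgMr.
  rewrite -[X in _ --> X](mulr0 (expR 1 : R)); apply: cvgMr.
  exact: expR_ln_cvg0.
apply: (squeeze_cvgr _ lim1 (cvg_cst (1 : R))); near=> n.
have n1 : (1 < n)%N by near: n; exact: nbhs_infty_gt.
have [l l_last] := last_ord n n1; rewrite (tv_dist_le1 _ _ l_last) andbT.
have := subcritical_coupon n1 eps_gt0 eps_lt1; rewrite -/(k n).
set mu := (n.-1)%:R * _; set e := _ * expR (- _) => mu_ge.
have e_gt0 : 0 < e by rewrite !mulr_gt0 ?expR_gt0.
have mu_gt0 : 0 < mu by apply: lt_le_trans mu_ge; rewrite invr_gt0.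
apply: le_trans (tv_dist_ge _ l_last mu_gt0); rewrite lerD2l lerN2.
have -> : 12 * (expR 1 * expR (- (eps * ln n%:R))) = 6 * e :> R by rewrite /e; ring.
by rewrite ler_wpM2l // -[e]invrK lef_pV2 ?posrE // invr_gt0.
Unshelve. all: by end_near. Qed.
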